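(* Let $\Gamma$ be a Singer cyclic lattice with presenting triple $(\sigma_0,\sigma_1,\sigma_2)$ and based difference matrix $E$, acting on its building $X$, and let $v_i$ be the vertex fixed by $\sigma_i$. Let $\ell\ge 1$. The Hjelmslev plane of level $\ell$ around $v_0$ is given by the following data. Its points are the end points $\sigma_0^{b^0}\sigma_1^{b^1}\cdots\sigma_{\ell-1}^{b^{\ell-1}}.v_{\ell}$ of (geodesic) forward-cycling edge paths $b^0\ldots b^{\ell-1}$ of length $\ell$. Its lines are the end points $\sigma_0^{a^0}\sigma_{-1}^{a^1}\cdots\sigma_{-(\ell-1)}^{a^{\ell-1}}.v_{-\ell}$ of (geodesic) backward-cycling edge paths $a^0\ldots a^{\ell-1}$ of length $\ell$ (indices of the $\sigma$'s and $v$'s modulo $3$). The point given by $b^0\ldots b^{\ell-1}$ and the line given by $a^0\ldots a^{\ell-1}$ are incident if and only if there is a labeling $c\mapsto\lambda(c)$ of the chambers of the model triangle $T_\ell$ by rows of $E$ such that for every vertex $v$ of $T_\ell$ at combinatorial distance $<\ell$ from the base vertex $$\sum_{c>v}\varepsilon_c\,\lambda(c)_{\mathrm{typ}(v)}=\sum_{e>v}\varepsilon_e\,\lambda(e)\quad\text{in }\mathbb Z/\delta\mathbb Z .$$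
   Context: Let $q$ be a prime power and $\delta=q^2+q+1$. A building of type $\tilde A_2$ is a simply connected 2-dimensional simplicial complex in which the link of every vertex is the incidence graph of a projective plane. Its vertices can be coloured by $\mathbb Z/3\mathbb Z$ so that every triangle (chamber) has one vertex of each colour (type). A Singer cyclic lattice with parameter $q$ is a group acting by type-preserving automorphisms on a locally finite building $X$ of type $\tilde A_2$ in which every edge lies in exactly $q+1$ triangles, such that the action is regular (transitive and free) on each of the three sets of edges of a given type and every vertex stabilizer is cyclic. A difference set in $\mathbb Z/\delta\mathbb Z$ is a subset $D$ such that every non-zero element is uniquely of the form $d-d'$, $d,d'\in D$. A based difference matrix is a $(q+1)\times3$ matrix $E$ over $\mathbb Z/\delta\mathbb Z$, columns indexed by $0,1,2$ (understood mod $3$), each of whose columns is as a set a difference set, and which has a row $(0,0,0)$; $D_i$ denotes the set of entries of column $i$. That $(\sigma_0,\sigma_1,\sigma_2)$ is a presenting triple with difference matrix $E$ means that $\Gamma=\langle\sigma_0,\sigma_1,\sigma_2\mid \sigma_i^\delta=1\ (0\le i\le 2),\ \sigma_0^{E_{j,0}}\sigma_1^{E_{j,1}}\sigma_2^{E_{j,2}}=1\ (1\le j\le q+1)\rangle$. Then each $\sigma_i$ generates the stabilizer of a unique vertex $v_i$ of $X$, the $v_i$ span a chamber, and types are chosen such that $v_i$ has type $i$. The elements of the Hjelmslev plane of level $\ell$ around $v_0$ are the vertices $v$ of $X$ that are end points of geodesic (straight) edge paths $v_0=v^0,v^1,\dots,v^\ell=v$ of length $\ell$; such a $v$ is a point if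 $v^1$ has type $1$ and a line if $v^1$ has type $2$. A point $x$ and a line $y$ are incident if there is a regular (flat equilateral) triangle in $X$ with side length $\ell$ and vertices $v_0,x,y$. A forward-cycling edge path $b^0\ldots b^{\ell-1}$ (with $b^k\in\mathbb Z/\delta\mathbb Z$) is the edge path with successive vertices $v_0,\ \sigma_0^{b^0}.v_1,\ \sigma_0^{b^0}\sigma_1^{b^1}.v_2,\ \dots,\ \sigma_0^{b^0}\cdots\sigma_{\ell-1}^{b^{\ell-1}}.v_\ell$; a backward-cycling edge path $a^0\ldots a^{\ell-1}$ is the one with successive vertices $v_0,\ \sigma_0^{a^0}.v_{-1},\ \sigma_0^{a^0}\sigma_{-1}^{a^1}.v_{-2},\dots$, indices mod $3$. Only geodesic paths are considered: $b^k\notin -D_{k \bmod 3}$ and $a^k\notin D_{-k\bmod 3}$ for $1\le k\le \ell-1$. The model triangle $T_\ell$ is the regular triangle of side length $\ell$ tiled by unit triangles (chambers). Its vertices are the pairs $(m,n)$ of integers with $m,n\ge0$, $m+n\le\ell$; the base vertex is $(0,0)$, corresponding to $v_0$, the combinatorial distance of $(m,n)$ from it is $m+n$, and $\mathrm{typ}(m,n)=m-n\bmod 3$. Its chambers are the triples $\{(m,n),(m+1,n),(m,n+1)\}$ and $\{(m+1,n),(m,n+1),(m+1,n+1)\}$ contained in $T_\ell$; $\varepsilon_c=+1$ for the first kind and $\varepsilon_c=-1$ for the second kind (so the chamber containing the base vertex is positive and adjacent chambers have opposite sign). The edges on the two sides through $(0,0)$ are oriented away from $(0,0)$; the edge from $(k,0)$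 to $(k+1,0)$ has label $\lambda(e)=b^k$, the edge from $(0,k)$ to $(0,k+1)$ has label $\lambda(e)=a^k$, and all other edges (with any orientation) have label $0$. The sign $\varepsilon_e$ of an oriented edge is $+1$ if it points from a vertex of type $i$ to one of type $i+1$, and $-1$ if it points from type $i$ to type $i-1$. Write $c>v$ if the chamber $c$ contains $v$, and $e>v$ if the oriented edge $e$ contains $v$ and points away from it. $\lambda(c)_i$ denotes the entry of the row $\lambda(c)$ in column $i$.
   Formalization: Geodesic is taken in its geometric sense (straight edge path in X) instead of by the conditions b^k ∉ -D_k, a^k ∉ D_{-k}, whose signs are wrong for the stated relations: for 0 ≠ d ∈ D_1 the path v_0, v_1, σ_1^d.v_2 satisfies them but ends at a neighbour of v_0. *)

(* Defs.v *)
(* Mathematical Components, with finmap for finite subsets of an infinite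
   vertex set and monoid.groupType for possibly infinite groups. *)
From HB Require Import structures.
From mathcomp Require Import all_boot all_order all_algebra finmap.
Set Implicit Arguments.
Unset Strict Implicit.
Unset Printing Implicit Defensive.
Import GRing.Theory.
Local Open Scope fset_scope.
Local Open Scope ring_scope.

Definition prime_power (q : nat) : Prop :=
  exists p k : nat, [/\ prime p, (0 < k)%N & q = (p ^ k)%N].

Definition delta (q : nat) : nat := (q ^ 2 + q + 1)%N.

(* ---- Simplicial complexes ------------------------------------------------ *)

Definition simplicial_complex (V : choiceType) (K : {pred {fset V}}) : Prop :=
  [/\ fset0 \notin K,
      forall x : V, [fset x] \in K
    & forall s t : {fset V}, s \in K -> t `<=` s -> t != fset0 -> t \in K].

(* The dimension of a simplex is its number of vertices minus one. *)
Definition two_dimensional (V : choiceType) (K : {pred {fset V}}) : Prop :=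
  (forall s, s \in K -> #|` s| <= 3)%N /\ exists2 s, s \in K & #|` s| = 3.

Definition adj (V : choiceType) (K : {pred {fset V}}) : rel V :=
  fun x y => (x != y) && ([fset x; y] \in K).

(* {x, y, z} is a triangle, i.e. y and z are adjacent in the link of x. *)
Definition chamber (V : choiceType) (K : {pred {fset V}}) (x y z : V) : bool :=
  uniq [:: x; y; z] && ([fset x; y; z] \in K).

(* Consecutive vertices of an edge path may coincide ([fset x; x] = [fset x]),
   as usual in the definition of the edge path group. *)
Definition edge_rel (V : choiceType) (K : {pred {fset V}}) : rel V :=
  fun x y => [fset x; y] \in K.

(* Combinatorial homotopy of edge paths relative to their end points: the
   relation defining the edge path group, which is the fundamental group of
   the geometric realization. Backtracking x y x ~ x is the case z = x of
   htp_simplex followed by htp_stutter. *)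
Inductive homotopic (V : choiceType) (K : {pred {fset V}}) :
    seq V -> seq V -> Prop :=
  | htp_refl p : homotopic K p p
  | htp_sym p p' : homotopic K p p' -> homotopic K p' p
  | htp_trans p p' p'' :
      homotopic K p p' -> homotopic K p' p'' -> homotopic K p p''
  | htp_stutter s t x : homotopic K (s ++ x :: x :: t) (s ++ x :: t)
  | htp_simplex s t x y z : [fset x; y; z] \in K ->
      homotopic K (s ++ x :: y :: z :: t) (s ++ x :: z :: t).

Definition simply_connected (V : choiceType) (K : {pred {fset V}}) : Prop :=
  [/\ exists x : V, True,
      forall x y : V, exists2 p, path (edge_rel K) x p & last x p = y
    & forall (x : V) (p : seq V), path (edge_rel K) x p -> last x p = x ->
        homotopic K (x :: p) [:: x]].

(* ---- Buildings of type A~_2 ---------------------------------------------- *)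

Record projective_plane : Type := ProjectivePlane {
  pp_point : Type;
  pp_line : Type;
  pp_inc : pp_point -> pp_line -> Prop;
  pp_join : forall x y, x <> y -> exists! l, pp_inc x l /\ pp_inc y l;
  pp_meet : forall l m, l <> m -> exists! x, pp_inc x l /\ pp_inc x m;
  pp_quad : exists x : 'I_4 -> pp_point, injective x /\
    forall i j k : 'I_4, uniq [:: i; j; k] ->
      ~ exists l, [/\ pp_inc (x i) l, pp_inc (x j) l & pp_inc (x k) l]
}.

Definition incidence_graph (Pi : projective_plane)
    (s t : pp_point Pi + pp_line Pi) : Prop :=
  match s, t with
  | inl x, inr l | inr l, inl x => pp_inc x l
  | _, _ => False
  end.

(* The link of v, as a graph, is isomorphic (via f) to the incidence graph of
   a projective plane. *)
Definition link_projective_plane (V : choiceType) (K : {pred {fset V}})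
    (v : V) : Prop :=
  exists (Pi : projective_plane) (f : pp_point Pi + pp_line Pi -> V),
    [/\ injective f,
        forall y, adj K v y <-> exists s, f s = y
      & forall s t, chamber K v (f s) (f t) <-> incidence_graph s t].

Record A2_building (V : choiceType) (K : {pred {fset V}}) : Prop := {
  bld_complex : simplicial_complex K;
  bld_dim : two_dimensional K;
  bld_sc : simply_connected K;
  bld_link : forall v : V, link_projective_plane K v
}.

Definition type_function (V : choiceType) (K : {pred {fset V}})
    (typ : V -> 'Z_3) : Prop :=
  forall s, s \in K -> #|` s| = 3 ->
    forall i : 'Z_3, exists! x, x \in s /\ typ x = i.

Definition simplex_type (V : choiceType) (typ : V -> 'Z_3) (s : {fset V}) :
  {fset 'Z_3} := [fset typ x | x in s].

Definition locally_finite (V : choiceType) (K : {pred {fset V}}) : Prop :=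
  forall x : V, exists A : {fset {fset V}},
    forall s, s \in K -> x \in s -> s \in A.

Definition edge_in_exactly (V : choiceType) (K : {pred {fset V}}) (n : nat) :
    Prop :=
  forall e : {fset V}, e \in K -> #|` e| = 2 ->
    exists A : {fset {fset V}}, #|` A| = n /\
      forall s, s \in A <-> [/\ s \in K, #|` s| = 3 & e `<=` s].

(* ---- Singer cyclic lattices ---------------------------------------------- *)

Definition cyclic_gen (G : groupType) (s g : G) : Prop :=
  exists n : nat, (g = s ^+ n \/ g = s ^- n)%g.

Definition stabilizer (V : Type) (G : groupType) (act : G -> V -> V) (x : V)
  (g : G) : Prop := act g x = x.

Record typed_action (V : choiceType) (K : {pred {fset V}}) (typ : V -> 'Z_3)
    (G : groupType) (act : G -> V -> V) : Prop := {
  act_one : forall x, act 1%g x = x;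
  act_mul : forall g h x, act (g * h)%g x = act g (act h x);
  act_simplex : forall g (s : {fset V}), s \in K -> [fset act g x | x in s] \in K;
  act_typ : forall g x, typ (act g x) = typ x
}.

Record singer_cyclic_lattice (q : nat) (V : choiceType) (K : {pred {fset V}})
    (typ : V -> 'Z_3) (G : groupType) (act : G -> V -> V) : Prop := {
  scl_building : A2_building K;
  scl_locally_finite : locally_finite K;
  scl_order : edge_in_exactly K q.+1;
  scl_typ : type_function K typ;
  scl_action : typed_action K typ act;
  scl_regular : forall e e' : {fset V},
    e \in K -> e' \in K -> #|` e| = 2 -> #|` e'| = 2 ->
    simplex_type typ e = simplex_type typ e' ->
    exists! g : G, [fset act g x | x in e] = e';
  scl_cyclic : forall x : V, exists s : G,
    forall g, stabilizer act x g <-> cyclic_gen s g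
}.

(* ---- Difference matrices and presentations ------------------------------- *)

Definition difference_set (n : nat) (D : {set 'Z_n}) : Prop :=
  forall x : 'Z_n, x != 0 ->
    exists! d : 'Z_n * 'Z_n, [/\ d.1 \in D, d.2 \in D & x = d.1 - d.2].

Definition column_set (q : nat) (E : 'M['Z_(delta q)]_(q.+1, 3)) (i : 'Z_3) :
  {set 'Z_(delta q)} := [set E j i | j : 'I_q.+1].

Definition based_difference_matrix (q : nat)
    (E : 'M['Z_(delta q)]_(q.+1, 3)) : Prop :=
  (forall i : 'Z_3, difference_set (column_set E i)) /\
  exists j, forall i, E j i = 0.

(* Words over the generators; the letter (i, true) is the inverse of the
   generator i and (i, false) is the generator itself. *)
Definition word (I : Type) : Type := seq (I * bool).

Definition gen_pow (I : Type) (i : I) (n : nat) : word I := nseq n (i, false).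

(* w and w' represent the same element of the group < I | R >. *)
Inductive presented_eq (I : Type) (R : word I -> Prop) :
    word I -> word I -> Prop :=
  | pe_refl w : presented_eq R w w
  | pe_sym w w' : presented_eq R w w' -> presented_eq R w' w
  | pe_trans w w' w'' :
      presented_eq R w w' -> presented_eq R w' w'' -> presented_eq R w w''
  | pe_cancel s t i b :
      presented_eq R (s ++ (i, b) :: (i, ~~ b) :: t) (s ++ t)
  | pe_relator s t r : R r -> presented_eq R (s ++ r ++ t) (s ++ t).

Definition eval_word (I : Type) (G : groupType) (sigma : I -> G) (w : word I) :
    G :=
  (\prod_(x <- w) (if x.2 then (sigma x.1)^-1 else sigma x.1))%g.

(* G = < I | R >, the generator i being sent to sigma i. *)
Definition presented_by (I : Type) (G : groupType) (sigma : I -> G)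
    (R : word I -> Prop) : Prop :=
  (forall g : G, exists w, eval_word sigma w = g) /\
  (forall w w' : word I,
     eval_word sigma w = eval_word sigma w' <-> presented_eq R w w').

Inductive singer_relator (q : nat) (E : 'M['Z_(delta q)]_(q.+1, 3)) :
    word 'Z_3 -> Prop :=
  | rel_order (i : 'Z_3) : singer_relator E (gen_pow i (delta q))
  | rel_row (j : 'I_q.+1) : singer_relator E
      (gen_pow (0 : 'Z_3) (E j 0) ++ gen_pow (1 : 'Z_3) (E j 1)
         ++ gen_pow (2%:R : 'Z_3) (E j 2%:R)).

Definition presenting_triple (q : nat) (G : groupType) (sigma : 'Z_3 -> G)
    (E : 'M['Z_(delta q)]_(q.+1, 3)) : Prop :=
  based_difference_matrix E /\ presented_by sigma (singer_relator E).

(* The vertices fixed by the generators of a presenting triple. *)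
Record base_chamber (V : choiceType) (K : {pred {fset V}}) (typ : V -> 'Z_3)
    (G : groupType) (act : G -> V -> V) (sigma : 'Z_3 -> G) (v : 'Z_3 -> V) :
    Prop := {
  bc_stab : forall i g, stabilizer act (v i) g <-> cyclic_gen (sigma i) g;
  bc_chamber : chamber K (v 0) (v 1) (v 2%:R);
  bc_typ : forall i, typ (v i) = i
}.

(* ---- The model triangle -------------------------------------------------- *)

Definition in_model (l : nat) (p : nat * nat) : bool := (p.1 + p.2 <= l)%N.

Definition mtyp (p : nat * nat) : 'Z_3 := p.1%:R - p.2%:R.

Definition corners (m n : nat) (positive : bool) : seq (nat * nat) :=
  if positive then [:: (m, n); (m.+1, n); (m, n.+1)]
  else [:: (m.+1, n); (m, n.+1); (m.+1, n.+1)].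

(* Chambers of T_l, encoded by (m, n, sign). *)
Definition mchamber (l : nat) : Type :=
  {c : 'I_l * 'I_l * bool | all (in_model l) (corners c.1.1 c.1.2 c.2)}.

Definition mcorners (l : nat) (c : mchamber l) : seq (nat * nat) :=
  corners (val c).1.1 (val c).1.2 (val c).2.

Definition chamber_sign (l : nat) (R : pzRingType) (c : mchamber l) : R :=
  if (val c).2 then 1 else -1.

(* End points of the oriented edges of T_l that point away from p. Edges on the
   two sides through (0,0) are oriented away from (0,0); an edge between
   (m+1,n) and (m,n+1) is given the orientation (m+1,n) -> (m,n+1), and the
   remaining edges that of the parallel sides. *)
Definition out_edges (l : nat) (p : nat * nat) : seq (nat * nat) :=
  [seq w <- [:: (p.1.+1, p.2); (p.1, p.2.+1)]
              ++ (if p.1 is m.+1 then [:: (m, p.2.+1)] else [::]) | in_model l w].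

Definition edge_sign (R : pzRingType) (p w : nat * nat) : R :=
  if mtyp w == mtyp p + 1 then 1 else -1.

Definition edge_label (d : nat) (b a : seq 'Z_d) (p w : nat * nat) : 'Z_d :=
  if (p.2 == 0%N) && (w.2 == 0%N) then b`_(p.1)
  else if (p.1 == 0%N) && (w.1 == 0%N) then a`_(p.2)
  else 0.

Definition labeling_condition (q l : nat) (E : 'M['Z_(delta q)]_(q.+1, 3))
    (b a : l.-tuple 'Z_(delta q)) (lam : mchamber l -> 'I_q.+1) : Prop :=
  forall p : nat * nat, (p.1 + p.2 < l)%N ->
    \sum_(c : mchamber l | p \in mcorners c)
        chamber_sign 'Z_(delta q) c * E (lam c) (mtyp p)
    = \sum_(w <- out_edges l p) edge_sign 'Z_(delta q) p w * edge_label b a p w.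

(* ---- Geodesic paths and Hjelmslev planes --------------------------------- *)

(* y and z are opposite in the link of x, a graph of diameter 3. Since an edge
   of a link has length pi/3, this says that y, x, z form an angle >= pi. *)
Definition opposite (V : choiceType) (K : {pred {fset V}}) (x y z : V) : Prop :=
  forall p : seq V, path (chamber K x) y p -> last y p = z -> (3 <= size p)%N.

(* p 0, ..., p l is a geodesic edge path of the CAT(0) space X: by the
   local-to-global principle, geodesic means straight at each inner vertex. *)
Definition geodesic_path (V : choiceType) (K : {pred {fset V}}) (l : nat)
    (p : nat -> V) : Prop :=
  (forall k, (k < l)%N -> adj K (p k) (p k.+1)) /\
  (forall k, (k.+1 < l)%N -> opposite K (p k.+1) (p k) (p k.+2)).

(* f embeds T_l into X as a subcomplex. *)
Definition regular_triangle (V : choiceType) (K : {pred {fset V}}) (l : nat)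
    (f : nat * nat -> V) : Prop :=
  {in in_model l &, injective f} /\
  forall c : mchamber l, [fset f p | p in mcorners c] \in K.

Definition hjelmslev_element (V : choiceType) (K : {pred {fset V}})
    (typ : V -> 'Z_3) (v0 : V) (l : nat) (i : 'Z_3) (x : V) : Prop :=
  exists p : nat -> V,
    [/\ geodesic_path K l p, p 0%N = v0, p l = x & typ (p 1%N) = i].

Definition hjelmslev_point V K typ v0 l x :=
  @hjelmslev_element V K typ v0 l 1 x.

Definition hjelmslev_line V K typ v0 l x :=
  @hjelmslev_element V K typ v0 l 2%:R x.

Definition hjelmslev_incident (V : choiceType) (K : {pred {fset V}}) (v0 : V)
    (l : nat) (x y : V) : Prop :=
  exists f : nat * nat -> V,
    [/\ regular_triangle K l f, f (0, 0)%N = v0, f (l, 0%N) = x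
      & f (0%N, l) = y].

(* The m-th vertex of the forward-cycling edge path b; it is
   sigma_0^{b^0} ... sigma_{m-1}^{b^{m-1}} . v_m . With the relations of
   singer_relator, sigma_k^b . v_(k+1) and v_(k-1) are adjacent in the link of
   v_k exactly when b lies in column_set E k. *)
Definition forward_path (d : nat) (V : Type) (G : groupType)
    (act : G -> V -> V) (sigma : 'Z_3 -> G) (v : 'Z_3 -> V) (b : seq 'Z_d)
    (m : nat) : V :=
  act (\prod_(k < m) sigma (k%:R)%R ^+ (b`_k)%R)%g (v m%:R).

Definition backward_path (d : nat) (V : Type) (G : groupType)
    (act : G -> V -> V) (sigma : 'Z_3 -> G) (v : 'Z_3 -> V) (a : seq 'Z_d)
    (m : nat) : V :=
  act (\prod_(k < m) sigma (- k%:R)%R ^+ (a`_k)%R)%g (v (- m%:R)).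

(* Main.v *)
Require Import Defs.
From HB Require Import structures.
From mathcomp Require Import all_boot all_order all_algebra finmap.
From mathcomp Require Import zify ring.
From Stdlib Require Import Relations Classical.
Set Implicit Arguments.
Unset Strict Implicit.
Unset Printing Implicit Defensive.
Import GRing.Theory.
Local Open Scope fset_scope.
Local Open Scope ring_scope.

(** The proof combines a geometric fact about buildings of type A~_2 with an
    angle count in Z/delta at the vertices of the model triangle.

    Geometry. Call an edge forward if it raises the type by one, and backward
    otherwise. An edge path can be simplified by cancelling a backtracking,
    cutting across a chamber, or replacing a backward edge followed by a forward
    one by a forward edge followed by a backward one, around the unique common
    neighbour of the two end points in the link of the middle vertex. This
    rewriting terminates, and it is locally confluent because links are
    generalized triangles; so it has unique normal forms. As the building is
    simply connected, any two edge paths with the same end points have the same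
    normal form (reduced_path_unique). Geodesic edge paths are normal forms, and
    this replaces the CAT(0) geometry of the building: geodesics are determined
    by their end points, three pairwise adjacent vertices span a chamber (flag),
    and a simplicial map from the model triangle which sends chambers to chambers
    and whose two sides at the base vertex are geodesic is an embedding
    (immersed_injective), because it cannot fold.

    Algebra. The powers of sigma_i permute the neighbours of v_i of a given type
    simply transitively. A priori the order of sigma_i only divides delta, but
    the projective plane in the link makes the exponents n for which
    sigma_i^n v_(i+1) is adjacent to v_(i-1) a difference set with q+1 elements
    modulo the order, so that the order is delta. By the relators and the flag
    property this set contains the i-th column of E, hence is equal to it
    (chamber_row). So every chamber is a translate of exactly one of the q+1
    chambers given by the rows of E. In a frame at one of its vertices, of type
    i, the labels in Z/delta of the two other vertices differ by the entry of
    that row in column i, and this row is the same for all three vertices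
    (row_label_turn).

    Incidence. Given a triangle in the building, label its chambers by their
    rows. Walking around a vertex, the alternating sum of the labels telescopes:
    to 0 at an inner vertex, and to the label of the next edge on a side, where
    the frame given by the path makes the previous vertex have label 0
    (labelled_star). Conversely a labelling is developed column by column into
    the building, starting from the bottom side; the condition at a vertex says
    that the chambers around it close up, and on the left side that it follows
    the given path (developed_step, developed_left). The developed triangle is
    embedded by the geometric part. *)

(** * Abstract rewriting *)

Section Rewriting.
Variables (T : Type) (R : relation T) (mu : T -> nat).

Local Notation rtc := (clos_refl_trans T R).
Local Notation conv := (clos_refl_sym_trans T R).

Definition joinable (a b : T) : Prop := exists2 c, rtc a c & rtc b c.

Definition irreducible (a : T) : Prop := forall b, ~ R a b.

Lemma joinable_sym a b : joinable a b -> joinable b a.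
Proof. by case=> c; exists c. Qed.

Lemma joinable_refl a : joinable a a.
Proof. by exists a; apply: rt_refl. Qed.

Lemma rtc_head a c : rtc a c -> a = c \/ exists2 b, R a b & rtc b c.
Proof.
move=> h; elim: (clos_rt_rt1n _ _ _ _ h) => [|x y z Rxy yz _]; first by left.
by right; exists y => //; apply: clos_rt1n_rt.
Qed.

Hypothesis mu_dec : forall a b, R a b -> (mu b < mu a)%N.
Hypothesis local_confluence : forall a b c, R a b -> R a c -> joinable b c.

Lemma newman a b c : rtc a b -> rtc a c -> joinable b c.
Proof.
have [n] := ubnP (mu a); elim: n a b c => // n IH a b c /ltnSE-le_an ab ac.
have [<-|[a1 Ra1 a1b]] := rtc_head ab; first by exists c => //; apply: rt_refl.
have [<-|[a2 Ra2 a2c]] := rtc_head ac; first by exists b => //; apply: rt_refl.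
have [d a1d a2d] := local_confluence Ra1 Ra2.
have lt1 := leq_trans (mu_dec Ra1) le_an.
have lt2 := leq_trans (mu_dec Ra2) le_an.
have [e be de] := IH _ _ _ lt1 a1b a1d.
have [f ef cf] := IH _ _ _ lt2 (rt_trans _ _ _ _ _ a2d de) a2c.
by exists f => //; apply: rt_trans be ef.
Qed.

Lemma church_rosser a b : conv a b -> joinable a b.
Proof.
elim=> {a b} [a b Rab|a|a b _ /joinable_sym //|a b c _ [d ad bd] _ [e be ce]].
- by exists b; [apply: rt_step | apply: rt_refl].
- by exists a; apply: rt_refl.
- have [f df ef] := newman bd be.
  by exists f; [apply: rt_trans ad df | apply: rt_trans ce ef].
Qed.

Lemma conv_irreducible a b : conv a b -> irreducible a -> irreducible b -> a = b.
Proof.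
move=> /church_rosser[c ac bc] irr_a irr_b.
have [->|[d /irr_a//]] := rtc_head ac.
by have [->|[d /irr_b//]] := rtc_head bc.
Qed.

End Rewriting.

(** * Types in Z/3 *)

Lemma Z3_add2 (i : 'Z_3) : i + 1 + 1 = i - 1.
Proof. by apply/eqP; case: i => [[|[|[|]]]]. Qed.

Lemma Z3_sub2 (i : 'Z_3) : i - 1 - 1 = i + 1.
Proof. by apply/eqP; case: i => [[|[|[|]]]]. Qed.

Lemma Z3_neq (i : 'Z_3) : [/\ i + 1 != i, i - 1 != i & i + 1 != i - 1].
Proof. by split; case: i => [[|[|[|]]]]. Qed.

Lemma Z3_other (i j : 'Z_3) : i != j -> j = i + 1 \/ j = i - 1.
Proof.
move=> ne; have /orP[/eqP|/eqP]: (j == i + 1) || (j == i - 1); [|by left|by right].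
by move: ne; case: i => [[|[|[|]]]] //; case: j => [[|[|[|]]]].
Qed.

Lemma Z3P (i : 'Z_3) : [\/ i = 0, i = 1 | i = 2%:R].
Proof.
suff /or3P[/eqP ?|/eqP ?|/eqP ?]: [|| i == 0, i == 1 | i == 2%:R];
  by [apply: Or31|apply: Or32|apply: Or33|case: i => [[|[|[|]]]]].
Qed.

(** * Projective planes as links *)

Section Links.
Variables (V : choiceType) (K : {pred {fset V}}) (typ : V -> 'Z_3).
Hypotheses (hX : A2_building K) (htyp : type_function K typ).

Local Notation adj := (adj K).
Local Notation ch := (chamber K).

Lemma chamberC x y z : ch x y z = ch x z y.
Proof.
rewrite /chamber (_ : [fset x; z; y] = [fset x; y; z]).
  by rewrite /= !inE (eq_sym z y) (orbC (x == y)).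
by apply/fsetP=> t; rewrite !inE orbAC.
Qed.

Lemma chamberR x y z : ch x y z = ch y z x.
Proof.
rewrite /chamber (_ : [fset y; z; x] = [fset x; y; z]).
  by rewrite -(rot_uniq 1 [:: x; y; z]).
by apply/fsetP=> t; rewrite !inE; case: (t == x); rewrite ?orbT ?orbF.
Qed.

Lemma chamberS x y z : ch x y z = ch y x z.
Proof. by rewrite chamberR chamberC. Qed.

Lemma adjC x y : adj x y = adj y x.
Proof.
rewrite /Defs.adj eq_sym (_ : [fset y; x] = [fset x; y]) //.
by apply/fsetP=> t; rewrite !inE orbC.
Qed.

Lemma chamberE x y z :
  ch x y z = [&& x != y, x != z, y != z & [fset x; y; z] \in K].
Proof. by rewrite /chamber /= !inE negb_or andbT -!andbA. Qed.

Lemma chamber_neq x y z : ch x y z -> [/\ x <> y, y <> z & x <> z].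
Proof. by rewrite chamberE => /and4P[/eqP xy /eqP xz /eqP yz _]. Qed.

Lemma adj_irr x : ~ adj x x.
Proof. by rewrite /Defs.adj eqxx. Qed.

Lemma chamber_adj x y z : ch x y z -> adj x y.
Proof.
have [_ _ hface] := bld_complex hX.
rewrite chamberE => /and4P[xy _ _ xyzK].
rewrite /Defs.adj xy /=; apply: (hface _ _ xyzK).
  by apply/fsubsetP=> t; rewrite !inE => ->.
by apply/fset0Pn; exists x; rewrite !inE eqxx.
Qed.

Lemma chamber_adj3 x y z : ch x y z -> [/\ adj x y, adj y z & adj x z].
Proof.
move=> c; split; first exact: chamber_adj c.
  by move: c; rewrite chamberR => /chamber_adj.
by move: c; rewrite chamberC => /chamber_adj.
Qed.

Lemma chamber_card x y z : ch x y z -> #|` [fset x; y; z]| = 3.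
Proof.
rewrite chamberE => /and4P[xy xz yz _].
by rewrite fsetUC cardfsU1 !inE negb_or eq_sym xz (eq_sym z) yz cardfs2 xy.
Qed.

Lemma chamber_typ_neq x y z : ch x y z -> typ x != typ y.
Proof.
move=> c; apply/eqP=> Exy.
have := c; rewrite chamberE => /and4P[xy _ _ xyzK].
have [w [_ wu]] := htyp xyzK (chamber_card c) (typ x).
have Ex: w = x by apply: wu; split=> //; rewrite !inE eqxx.
have Ey: w = y by apply: wu; split=> //; rewrite !inE eqxx orbT.
by move: xy; rewrite -Ex Ey eqxx.
Qed.

Lemma chamber_typ x y z : ch x y z ->
  (typ y = typ x + 1 /\ typ z = typ x - 1) \/
  (typ y = typ x - 1 /\ typ z = typ x + 1).
Proof.
move=> c; have xy := chamber_typ_neq c.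
have := c; rewrite chamberR => /chamber_typ_neq yz.
have := c; rewrite chamberC => /chamber_typ_neq xz.
have [_ _ ne] := Z3_neq (typ x).
have [Ey|Ey] := Z3_other xy; have [Ez|Ez] := Z3_other xz.
- by move: yz; rewrite Ey Ez eqxx.
- by left.
- by right.
- by move: yz; rewrite Ey Ez eqxx.
Qed.

Lemma chamber_typ_eq x y z : ch x y z -> typ y = typ x + 1 -> typ z = typ x - 1.
Proof.
case/chamber_typ=> [[//]|[-> _]] /eqP; rewrite eq_sym.
by case: (Z3_neq (typ x)) => _ _ /negPf->.
Qed.

Lemma chamber_typ_eqN x y z : ch x y z -> typ y = typ x - 1 -> typ z = typ x + 1.
Proof.
by case/chamber_typ=> [[-> _]|[//]] /eqP; case: (Z3_neq (typ x)) => _ _ /negPf->.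
Qed.

Lemma chamber_typ_same y a b c : ch y a b -> ch y b c -> typ a = typ c.
Proof.
move=> yab; rewrite chamberC => ycb; move: yab; rewrite chamberC.
case/chamber_typ=> [] [Eb ->].
  by rewrite chamberC in ycb; rewrite (chamber_typ_eq ycb Eb).
by rewrite chamberC in ycb; rewrite (chamber_typ_eqN ycb Eb).
Qed.

(** The quadrangle axiom rules out an isolated point or line. *)
Lemma plane_incident (Pi : projective_plane) (s : pp_point Pi + pp_line Pi) :
  exists t, incidence_graph s t.
Proof.
have [x [xinj xcol]] := pp_quad Pi.
pose o0 : 'I_4 := @Ordinal 4 0 isT; pose o1 : 'I_4 := @Ordinal 4 1 isT.
pose o2 : 'I_4 := @Ordinal 4 2 isT.
have n01: x o0 <> x o1 by move/xinj.
have n02: x o0 <> x o2 by move/xinj.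
have [m [[m0 m1] _]] := pp_join n01.
have [n [[n0 n2] _]] := pp_join n02.
have mn: m <> n.
  by move=> E; apply: (xcol o0 o1 o2) => //; exists n; split=> //; rewrite -E.
case: s => [p|t].
  have [->|/pp_join[k [[pk _] _]]] := classic (p = x o0).
    by exists (inr m).
  by exists (inr k).
have [Etm|/pp_meet[z [[tz _] _]]] := classic (t = m).
  by exists (inl (x o0)); rewrite Etm.
by exists (inl z).
Qed.

Lemma edge_third x y s : adj x y -> s \in K -> #|` s| = 3 -> [fset x; y] `<=` s ->
  exists2 z, ch x y z & s = [fset x; y; z].
Proof.
case/andP=> nxy _ sK cs xys.
have : (0 < #|` s `\` [fset x; y]|)%N.
  by rewrite cardfsDS // cs cardfs2 nxy.
rewrite cardfs_gt0 => /fset0Pn[z]; rewrite !inE negb_or => /andP[/andP[zx zy] zs].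
have Es : [fset x; y; z] = s.
  apply/eqP; rewrite eqEfcard cs fsetUC cardfsU1 !inE negb_or zx zy.
  rewrite cardfs2 nxy /= andbT.
  apply/fsubsetP=> t; rewrite inE => /orP[|txy]; first by rewrite inE => /eqP->.
  exact: (fsubsetP xys).
by exists z; rewrite // chamberE nxy eq_sym zx eq_sym zy Es.
Qed.

Lemma adj_chamber x y : adj x y -> exists z, ch x y z.
Proof.
have [Pi [f [_ adjE chE]]] := bld_link hX x.
case/adjE=> s <-; have [t st] := plane_incident s.
by exists (f t); apply/chE.
Qed.

Lemma adj_typ x y : adj x y -> typ y = typ x + 1 \/ typ y = typ x - 1.
Proof. by case/adj_chamber=> z /chamber_typ[] [-> _]; [left|right]. Qed.

(** Types separate points from lines in a link: a point and a line are joined by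
    a path of odd length, along which the types alternate. *)
Lemma link_join y x z : adj y x -> adj y z -> typ x = typ z -> x <> z ->
  exists2 w, ch y x w & ch y w z.
Proof.
have [Pi [f [_ adjE chE]]] := bld_link hX y.
have pl p m : typ (f (inl p)) != typ (f (inr m)).
  have [[r|//] rm] := plane_incident (inr m).
  have /chE rmc : incidence_graph (inl r) (inr m) by [].
  have [->|/pp_join[k [[pk rk] _]]] := classic (p = r).
    by move: rmc; rewrite chamberR => /chamber_typ_neq.
  have prc : ch y (f (inl p)) (f (inr k)) by apply/chE.
  have krc : ch y (f (inr k)) (f (inl r)) by apply/chE.
  rewrite (chamber_typ_same prc krc).
  by move: rmc; rewrite chamberR => /chamber_typ_neq.
case/adjE=> s <- /adjE[t <-] Et ne.
case: s t Et ne => [p|m] [r|n] Et ne; last 1 first.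
- have /pp_meet[k [[mk nk] _]] : m <> n by move=> E; apply: ne; rewrite E.
  by exists (f (inl k)); apply/chE.
- have /pp_join[k [[pk rk] _]] : p <> r by move=> E; apply: ne; rewrite E.
  by exists (f (inr k)); apply/chE.
- by have := pl p n; rewrite Et eqxx.
- by have := pl r m; rewrite Et eqxx.
Qed.

Lemma link_join_unique y x z w w' : x <> z ->
  ch y x w -> ch y w z -> ch y x w' -> ch y w' z -> w = w'.
Proof.
have [Pi [f [_ adjE chE]]] := bld_link hX y => ne xw wz xw' w'z.
have /adjE[s Es] := chamber_adj xw; have /adjE[t Et] := chamber_adj wz.
have /adjE[u Eu] := chamber_adj w'z.
have /adjE[r Er] : adj y z by case/chamber_adj3: wz.
move: ne xw wz xw' w'z; rewrite -{}Es -{}Et -{}Eu -{}Er => ne.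
move=> /chE st /chE tr /chE su /chE ur.
case: s st su ne => [p|m]; case: t tr => [x'|k]; case: u ur => [y'|k'] //=;
  case: r => [r|r] //=.
- move=> k'r kr pk pk' ne.
  have /pp_join[n [_ nu]] : p <> r by move=> E; apply: ne; rewrite E.
  by rewrite -(nu k) ?(nu k').
- move=> k'r kr pk pk' ne.
  have /pp_meet[n [_ nu]] : m <> r by move=> E; apply: ne; rewrite E.
  by rewrite -(nu x') ?(nu y').
Qed.

(** The link has girth at least six, so a path of length three without
    backtracking cannot be shortened. *)
Lemma link_path3_opposite y a b c d :
  ch y a b -> ch y b c -> ch y c d -> a <> c -> b <> d -> opposite K y a d.
Proof.
move=> ab bc cd ac bd [|x [|x' [|//]]] /=.
- move=> _ E; have := chamber_typ_same ab bc; rewrite E.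
  by move: cd; rewrite chamberR => /chamber_typ_neq /eqP cd Ed; case: cd; rewrite Ed.
- rewrite andbT => ax Ex; case: ac; rewrite Ex in ax.
  by apply: (link_join_unique bd _ ax bc cd); rewrite chamberC.
- case/and3P=> ax xx' _ E; rewrite E in xx'.
  have := chamber_typ_same ab bc; rewrite (chamber_typ_same ax xx').
  by move: cd; rewrite chamberR => /chamber_typ_neq /eqP cd Ed; case: cd; rewrite Ed.
Qed.

Lemma opposite_neq y a d : opposite K y a d -> a <> d.
Proof. by move=> o E; have := o [::] isT E. Qed.

Lemma opposite_chamberN y a d : opposite K y a d -> ~ ch y a d.
Proof. by move=> o c; have := o [:: d]; rewrite /= c => /(_ isT erefl). Qed.

Lemma opposite_typ y a d : adj y a -> adj y d -> opposite K y a d ->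
  typ a != typ d.
Proof.
move=> ya yd o; apply/eqP=> E.
have [w aw wd] := link_join ya yd E (opposite_neq o).
by have := o [:: w; d]; rewrite /= aw wd => /(_ isT erefl).
Qed.

End Links.

(** Closes a goal that is a hypothesis up to the order of the three vertices. *)
Ltac chamber_perm :=
  match goal with H : is_true (chamber _ _ _ _) |- is_true (chamber _ _ _ _) =>
    first [ exact H | by rewrite chamberC | by rewrite chamberS
          | by rewrite chamberR | by rewrite -chamberR
          | by rewrite chamberR chamberS ] end.

(** * Normal forms of edge paths *)

Section Paths.
Variables (V : choiceType) (K : {pred {fset V}}) (typ : V -> 'Z_3).
Hypotheses (hX : A2_building K) (htyp : type_function K typ).

Local Notation adj := (adj K).
Local Notation ch := (chamber K).

(** The swap is used in one direction only, as otherwise rewriting would not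
    terminate; a normal form is a straight run of forward edges followed by a
    straight run of backward edges. The stutter makes the relation generate the
    homotopy relation, whose paths may pause at a vertex. *)
Inductive shorten_head : seq V -> seq V -> Prop :=
  | sh_stutter x t : shorten_head (x :: x :: t) (x :: t)
  | sh_back x y t : adj x y -> shorten_head (x :: y :: x :: t) (x :: t)
  | sh_triangle x y z t : ch x y z ->
      shorten_head (x :: y :: z :: t) (x :: z :: t)
  | sh_swap x y z w t : typ x = typ y + 1 -> typ z = typ y + 1 -> x <> z ->
      ch y x w -> ch y w z -> shorten_head (x :: y :: z :: t) (x :: w :: z :: t).

Inductive shorten : seq V -> seq V -> Prop :=
  | shorten_here s s' : shorten_head s s' -> shorten s s'
  | shorten_cons x s s' : shorten s s' -> shorten (x :: s) (x :: s').

Local Notation rtc := (clos_refl_trans _ shorten).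

Lemma shorten_same_head s s' : shorten s s' ->
  exists x t t', s = x :: t /\ s' = x :: t'.
Proof. by case=> {s s'} [s s' []|]; do 3 eexists; split. Qed.

Lemma rtc1 a b : shorten a b -> rtc a b.
Proof. exact: rt_step. Qed.

Lemma rtc2 a b c : shorten a b -> shorten b c -> rtc a c.
Proof. by move=> ab bc; apply: rt_trans (rtc1 ab) (rtc1 bc). Qed.

Lemma rtc_cons x a b : rtc a b -> rtc (x :: a) (x :: b).
Proof.
elim=> {a b} [a b ab|a|a b c _ ab _ bc]; first by apply/rtc1/shorten_cons.
- exact: rt_refl.
- exact: rt_trans ab bc.
Qed.

Lemma shorten_tri x y z t : ch x y z -> shorten (x :: y :: z :: t) (x :: z :: t).
Proof. by move=> c; apply/shorten_here/sh_triangle. Qed.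

Lemma shorten_back x y t : adj x y -> shorten (x :: y :: x :: t) (x :: t).
Proof. by move=> c; apply/shorten_here/sh_back. Qed.

Lemma shorten_swap x y z w t : typ x = typ y + 1 -> typ z = typ y + 1 -> x <> z ->
  ch y x w -> ch y w z -> shorten (x :: y :: z :: t) (x :: w :: z :: t).
Proof. by move=> *; apply/shorten_here/sh_swap. Qed.

Lemma typ_succ_neq (i : 'Z_3) : i <> i + 1.
Proof. by case: (Z3_neq i) => + _ _; rewrite eq_sym => /eqP. Qed.

(** Closes the cases in which two rules would match the same three vertices. *)
Local Ltac degenerate := solve
  [ match goal with H : is_true (Defs.adj _ ?x ?x) |- _ =>
      by case: (adj_irr H) end
  | match goal with H : typ ?x = typ ?x + 1 |- _ => by case: (typ_succ_neq H) end
  | match goal with H : is_true (chamber _ _ _ _) |- _ =>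
      by case: (chamber_neq H) end
  | match goal with H : is_true (chamber _ ?x ?y ?z), Hx : typ ?x = _,
        Hz : typ ?z = _ |- _ =>
      by move: H; rewrite chamberC => /(chamber_typ_neq htyp); rewrite Hx Hz eqxx
    end ].

(** At a given place at most one rule applies, with one result. *)
Lemma shorten_head_fun s a b : shorten_head s a -> shorten_head s b -> a = b.
Proof.
case=> {s a} [x t|x y t xy|x y z t xyz|x y z w t tx tz xz yxw ywz];
  (move E: (x :: _) => u h; case: h E => {u b}
    [x' t'|x' y' t' xy'|x' y' z' t' xyz'|x' y' z' w' t' tx' tz' xz' yxw' ywz']
    E; case: E => *; subst => //; try degenerate).
by rewrite (link_join_unique hX xz yxw ywz yxw' ywz').
Qed.

(** The critical pairs, in which two redexes share an edge. All vertices
    involved lie in the star of one vertex, and each pair is resolved by the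
    chambers of that star; common neighbours of two vertices of the same type are
    unique, which is where the link has to be a projective plane. *)
Lemma shorten_overlap x s a b : shorten_head (x :: s) a -> shorten_head s b ->
  joinable shorten a (x :: b).
Proof.
move E: (x :: s) => u h; case: h E => {u a}
    [x' t|x' y t xy|x' y z t xyz|x' y z w t tx tz xz yxw ywz] E;
  case: E => ? ?; subst x' s.
- move=> h; exists b; first exact/rtc1/shorten_here.
  have [u [v [v' [[? _] ?]]]] := shorten_same_head (shorten_here h); subst u b.
  exact/rtc1/shorten_here/sh_stutter.
- move E: (y :: _) => u h; case: h E => {u b}
    [y' t'|y' y'' t' yy|y' x' z t' yxz|y' x' z w t' ty tz yz xyw xwz] E;
    case: E => *; subst; try degenerate.
  + exact: joinable_refl.
  + exists (x' :: z :: t'); first exact: rt_refl.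
    apply/rtc1/shorten_tri; chamber_perm.
  + exists (x' :: z :: t'); first exact: rt_refl.
    apply: (rtc2 (b := x' :: w :: z :: t')).
      apply/shorten_tri; chamber_perm.
    exact/shorten_tri.
- have [xy yz xz] := chamber_adj3 hX xyz.
  move E: (y :: _) => u h; case: h E => {u b}
    [y' t'|y' y'' t' yy|y' z' w t' yzw|y' z' u w t' ty tu yu zyw zwu] E;
    case: E => *; subst; try degenerate.
  + exists (x :: y' :: t'); last exact: rt_refl.
    apply/rtc1/shorten_tri; chamber_perm.
  + have zxy : ch z' x y' by chamber_perm.
    have zyw : ch z' y' w by chamber_perm.
    have txw : typ w = typ x by rewrite (chamber_typ_same htyp zxy zyw).
    have [<-|xw] := eqVneq x w.
      by exists (x :: t'); apply/rtc1/shorten_back.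
    have yxz : ch y' x z' by chamber_perm.
    (* The paths x z' w and x y' w go around the same two chambers; which of
       them is normal depends on the direction. *)
    have [xz1|[xz1 xy1]] :
        typ x = typ z' + 1 \/ typ x = typ z' - 1 /\ typ y' = typ z' + 1.
      by case: (chamber_typ htyp zxy) => [[-> _]|[-> ->]]; [left | right].
    * exists (x :: y' :: w :: t'); last exact: rt_refl.
      by apply/rtc1/shorten_swap; rewrite ?txw //; apply/eqP.
    * have xy2 : typ x = typ y' + 1 by rewrite xz1 xy1 Z3_add2.
      exists (x :: z' :: w :: t'); first exact: rt_refl.
      by apply/rtc1/shorten_swap; rewrite ?txw //; apply/eqP.
  + have zxy : ch z' x y' by chamber_perm.
    have tw : typ w = typ z' - 1 := chamber_typ_eq htyp zyw ty.
    have tx : typ x = typ z' - 1.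
      by rewrite (chamber_typ_same htyp zxy zyw).
    have zwx' : ch w u z' by chamber_perm.
    have [Exw|/eqP xw] := eqVneq x w.
      rewrite -{}Exw in zwx' zyw *; exists (x :: u :: t'); apply/rtc1.
        apply: shorten_tri; chamber_perm.
      exact: shorten_back.
    exists (x :: z' :: u :: t'); first exact: rt_refl.
    apply: (rtc2 (b := x :: z' :: w :: u :: t')); last first.
      apply/shorten_cons/shorten_tri; chamber_perm.
    apply: shorten_swap; rewrite ?tx ?tw ?ty ?Z3_add2 //.
      chamber_perm.
    chamber_perm.
- have tw : typ w = typ y - 1 := chamber_typ_eq htyp yxw tx.
  move E: (y :: _) => u h; case: h E => {u b}
    [y' t'|y' y'' t' yy|y' z' u t' yzu|y' z' u w' t' ty tu yu zyw zwu] E;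
    case: E => *; subst; try degenerate.
  + exists (x :: y' :: t'); last exact: rt_refl.
    apply: (rtc2 (b := x :: w :: y' :: t')).
      apply/shorten_cons/shorten_tri; chamber_perm.
    apply/shorten_tri; chamber_perm.
  + have ywz' : ch y' z' w by chamber_perm.
    have tu : typ u = typ y' - 1 := chamber_typ_eq htyp yzu tz.
    have [<-|/eqP wu] := eqVneq w u.
      exists (x :: w :: t'); apply/rtc1.
        by apply/shorten_cons/shorten_back; case: (chamber_adj3 hX ywz).
      apply: shorten_tri; chamber_perm.
    exists (x :: y' :: u :: t'); last exact: rt_refl.
    apply: (rtc2 (b := x :: w :: y' :: u :: t')).
      apply/shorten_cons/shorten_swap; rewrite ?tw ?tu ?tz ?Z3_add2 //.
        chamber_perm.
      chamber_perm.
    apply/shorten_tri; chamber_perm.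
  + by case: (Z3_neq (typ z')) => _ /eqP[]; rewrite -Z3_add2 -ty -tz.
Qed.

(** Redexes that share at most a vertex commute, since every rule keeps the end
    points of its redex. *)
Lemma shorten_head_tail x s a b : shorten_head (x :: s) a -> shorten s b ->
  joinable shorten a (x :: b).
Proof.
move=> ha hb; case: hb ha => {s b} [s b hb|y s b sb] ha.
  exact: shorten_overlap ha hb.
have [z [t [t' [Es Eb]]]] := shorten_same_head sb; subst s b.
move E: (x :: y :: z :: t) ha => u ha.
case: ha E sb => {u a}
  [x' r|x' y' r xy|x' y' z' r xyz|x' y' z' w r tx tz xz yxw ywz] E sb;
  case: E => *; subst.
- exists (x' :: z :: t'); apply/rtc1; first exact/shorten_cons.
  exact/shorten_here/sh_stutter.
- by exists (x' :: t'); apply/rtc1; [|apply/shorten_back].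
- by exists (x' :: z' :: t'); apply/rtc1; [apply/shorten_cons|apply/shorten_tri].
- exists (x' :: w :: z' :: t'); apply/rtc1.
    by do 2!apply/shorten_cons.
  exact/shorten_swap.
Qed.

Lemma shorten_confluent s a b : shorten s a -> shorten s b -> joinable shorten a b.
Proof.
move=> sa; elim: sa b => {s a} [s a ha|x s a sa IH] b hb.
  case: hb ha => {s b} [s b hb|x s b sb] ha.
    by rewrite (shorten_head_fun ha hb); apply: joinable_refl.
  exact: shorten_head_tail ha sb.
move E: (x :: s) (hb) => u h; case: h E => {u hb b} [u b hb|x' s' b sb] E.
  by rewrite -{}E in hb; apply/joinable_sym/shorten_head_tail/sa.
case: E => Ex Es; subst x' s'; have [c ac bc] := IH _ sb.
by exists (x :: c); apply: rtc_cons.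
Qed.

(** At distance d from the end of the path, a forward edge weighs d + 1 and a
    backward edge 2d + 1, so that moving a backward edge towards the end lowers
    the weight, and so does merging two edges into one of either kind. *)
Fixpoint path_weight (s : seq V) : nat :=
  if s is x :: t then
    if t is y :: u then
      ((typ y == typ x - 1)%R * size u + size u + 1 + path_weight t)%N
    else 0%N
  else 0%N.

Lemma shorten_weight s s' : shorten s s' ->
  (size s' <= size s)%N /\ (path_weight s' < path_weight s)%N.
Proof.
elim=> {s s'} [s s' h|x s s' ss' [le_s lt_w]].
  case: h => [x t|x y t xy|x y z t xyz|x y z w t tx tz xz yxw ywz] /=.
  - split; [lia|case: (typ x == _); lia].
  - by split; [lia|]; case: t => [|z t] /=; lia.
  - by split; [lia|]; do 2?case: (_ == _); case: t => [|u t] /=; lia.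
  - have tw : typ w = typ y - 1 := chamber_typ_eq htyp yxw tx.
    have [n1 n2 n3] := Z3_neq (typ y).
    rewrite tx tz tw addrK Z3_sub2 !eqxx (negPf n2) (negPf n3).
    by split; [lia|]; case: t => [|u t] /=; lia.
have [u [t [t' [Es Es']]]] := shorten_same_head ss'.
move: le_s lt_w; rewrite Es Es' /= => le_s lt_w; split; first by lia.
have : ((typ u == (typ x - 1)%R) * size t' <= (typ u == (typ x - 1)%R) * size t)%N.
  by apply: leq_mul => //; lia.
by lia.
Qed.

Local Notation conv := (clos_refl_sym_trans _ shorten).

Lemma shorten_cat a b t : shorten a b -> shorten (a ++ t) (b ++ t).
Proof.
elim=> {a b} [a b h|x a b _ IH] /=; last exact: shorten_cons.
by apply: shorten_here; case: h => *; constructor.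
Qed.

Lemma conv_context s a b t : conv a b -> conv (s ++ a ++ t) (s ++ b ++ t).
Proof.
elim=> {a b} [a b ab|a|a b _|a b c _ ab _].
- apply: rst_step; elim: s => [|x s IH] /=; [exact: shorten_cat|exact: shorten_cons].
- exact: rst_refl.
- exact: rst_sym.
- exact: rst_trans ab.
Qed.

Lemma homotopic_conv p p' : homotopic K p p' -> conv p p'.
Proof.
elim=> {p p'} [p|p p' _|p p' p'' _ pp' _|s t x|s t x y z xyzK].
- exact: rst_refl.
- exact: rst_sym.
- exact: rst_trans pp'.
- apply: (@conv_context s [:: x; x] [:: x] t).
  exact/rst_step/shorten_here/sh_stutter.
- apply: (@conv_context s [:: x; y; z] [:: x; z] t).
  have [<-|xy] := eqVneq x y; first exact/rst_step/shorten_here/sh_stutter.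
  have [<-|yz] := eqVneq y z.
    exact/rst_step/shorten_cons/shorten_here/sh_stutter.
  have [Exz|xz] := eqVneq x z; last first.
    by apply/rst_step/shorten_tri; rewrite chamberE xy xz yz.
  rewrite -Exz in xyzK *; apply: (@rst_trans _ _ _ [:: x]).
    apply/rst_step/shorten_back; rewrite /Defs.adj xy.
    rewrite (_ : [fset x; y] = [fset x; y; x]) //.
    by apply/fsetP=> u; rewrite !inE; case: (u == x); rewrite ?orbT ?orbF.
  exact/rst_sym/rst_step/shorten_here/sh_stutter.
Qed.

Lemma conv_backtrack x p : path adj x p ->
  conv (last x p :: rev (belast x p) ++ p) [:: last x p].
Proof.
elim/last_ind: p => [|p z IH]; first by move=> _; apply: rst_refl.
rewrite rcons_path last_rcons belast_rcons => /andP[px az].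
rewrite (lastI x p) rev_rcons -cats1; apply: (@rst_trans _ _ _ [:: z; last x p; z]).
  rewrite catA; exact: (conv_context [:: z] [:: z] (IH px)).
by apply/rst_step/shorten_back; rewrite adjC.
Qed.

(** The first path is followed by the second one backwards and forwards; the
    first half of this is a loop, hence homotopic to a constant path. *)
Lemma conv_same_ends x p p' : path adj x p -> path adj x p' ->
  last x p = last x p' -> conv (x :: p) (x :: p').
Proof.
move=> xp xp' Elast.
have edge y z : adj y z -> edge_rel K y z by case/andP.
have loop : path (edge_rel K) x (p ++ rev (belast x p')).
  rewrite cat_path (sub_path edge xp) Elast rev_path.
  by apply: sub_path xp' => y z; rewrite adjC; apply: edge.
have [_ _ /(_ _ _ loop) sc] := bld_sc hX.
have /homotopic_conv : homotopic K (x :: p ++ rev (belast x p')) [:: x].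
  apply: sc; rewrite last_cat; case: p' Elast {xp' loop} => [|y p'] //= _.
  by rewrite rev_cons last_rcons.
move/(conv_context [::] p') => /= loop_conv; apply: rst_trans loop_conv.
rewrite -catA -cat_cons lastI -cats1 -catA.
have /(conv_context (belast x p) [::]) := rst_sym _ _ _ _ (conv_backtrack xp').
by rewrite -Elast /= cats0.
Qed.

(** ** Reduced paths *)

Definition reduced_step (x y z : V) : Prop :=
  [/\ x <> z, ~ ch x y z & ~ (typ x = typ y + 1 /\ typ z = typ y + 1)].

Definition reduced_path (n : nat) (p : nat -> V) : Prop :=
  (forall k, (k < n)%N -> adj (p k) (p k.+1)) /\
  (forall k, (k.+1 < n)%N -> reduced_step (p k) (p k.+1) (p k.+2)).

Lemma mkseqS_shift (T : Type) (p : nat -> T) n :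
  mkseq p n.+1 = p 0%N :: mkseq (fun k => p k.+1) n.
Proof. by rewrite /mkseq /= -[1%N]addn0 iotaDl -map_comp. Qed.

Lemma reduced_shift n p : reduced_path n.+1 p -> reduced_path n (fun k => p k.+1).
Proof. by case=> h1 h2; split=> k kn; [apply: h1|apply: h2]. Qed.

Lemma reduced_irreducible n p : reduced_path n p ->
  irreducible shorten (mkseq p n.+1).
Proof.
elim: n p => [|n IH] p hp b.
  move E: (mkseq _ _) => u h; case: h E => {u b} [u b []|x s s' h] //= [_ Es].
  by rewrite -Es in h; have [? [? [? []]]] := shorten_same_head h.
rewrite mkseqS_shift; move E: (_ :: _) => u h; case: h E => {u b} [u b h|x s s' h] E.
  case: hp => hadj hred.
  case: n {IH} hadj hred E => [|n] hadj hred; rewrite !mkseqS_shift => E.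
    case: h E => // x t [E0 E1 _]; have := hadj 0%N isT.
    by rewrite E0 E1 => /adj_irr.
  have [] := hred 0%N isT; have := hadj 0%N isT.
  case: h E => [x t|x y t xy|x y z t xyz|x y z w t tx tz xz yxw ywz] E.
  - by case: E => -> -> _ /adj_irr.
  - by case: E => -> _ -> _ _ [].
  - by case: E => -> -> -> _ _ _ [].
  - by case: E => -> -> -> _ _ _ _ [].
case: E => _ Es; rewrite -Es in h; exact: IH (reduced_shift hp) _ h.
Qed.

(** By simple connectivity both paths are convertible, and both are normal forms
    of a terminating and confluent relation. *)
Lemma reduced_path_unique n n' p p' : reduced_path n p -> reduced_path n' p' ->
  p 0%N = p' 0%N -> p n = p' n' ->
  n = n' /\ forall k, (k <= n)%N -> p k = p' k.
Proof.
move=> hp hp' E0 En.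
have pathP m r : reduced_path m r -> path adj (r 0%N) (mkseq (fun k => r k.+1) m).
  elim: m r => [//|m IH] r hr; rewrite mkseqS_shift /= (proj1 hr) //.
  exact: (IH _ (reduced_shift hr)).
have lastP m (r : nat -> V) : last (r 0%N) (mkseq (fun k => r k.+1) m) = r m.
  by elim: m r => [//|m IH] r; rewrite mkseqS_shift; apply: (IH (fun k => r k.+1)).
have Es : mkseq p n.+1 = mkseq p' n'.+1.
  apply: (@conv_irreducible _ _ path_weight) (reduced_irreducible hp)
    (reduced_irreducible hp').
  - by move=> a b /shorten_weight[].
  - exact: shorten_confluent.
  rewrite !mkseqS_shift -E0; apply: conv_same_ends; first exact: pathP.
    by rewrite E0; apply: pathP.
  by rewrite lastP E0 lastP.
have Enn : n = n' by have := congr1 size Es; rewrite !size_mkseq => -[].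
split=> // k kn.
rewrite -[LHS](nth_mkseq (p 0%N) p (n := n.+1)) // Es nth_mkseq //.
by rewrite -Enn.
Qed.

Lemma geodesic_ext n p p' : (forall k, (k <= n)%N -> p k = p' k) ->
  geodesic_path K n p -> geodesic_path K n p'.
Proof.
move=> E [padj popp]; split=> k kn.
  by rewrite -(E k (ltnW kn)) -(E k.+1 kn); apply: padj.
by rewrite -(E k (ltnW (ltnW kn))) -(E k.+1 (ltnW kn)) -(E k.+2 kn); apply: popp.
Qed.

Lemma opposite_reduced x y z : adj x y -> adj y z -> opposite K y x z ->
  reduced_step x y z.
Proof.
move=> xy yz o; split.
- exact: opposite_neq o.
- by rewrite chamberS; apply: opposite_chamberN.
- rewrite adjC in xy; case=> E1 E2.
  by have := opposite_typ hX htyp xy yz o; rewrite E1 E2 eqxx.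
Qed.

Lemma geodesic_reduced n p : geodesic_path K n p -> reduced_path n p.
Proof.
case=> hadj hopp; split=> // k kn.
by apply: opposite_reduced (hopp k kn); apply: hadj => //; apply: ltnW.
Qed.

(** Otherwise the path with two edges and the path with one edge would be distinct
    reduced paths with the same end points. *)
Lemma flag x y z : adj x y -> adj y z -> adj x z -> ch x y z.
Proof.
move=> xy yz xz; apply: NNPP => nc.
pose p k := if k is k'.+1 then (if k' is 0%N then y else z) else x.
pose p' k := if k is k'.+1 then z else x.
have hp : reduced_path 2 p.
  split=> [[|[|]]|[|]] //= _; split=> //.
    by move=> E; move: xz; rewrite E => /adj_irr.
  case=> E1 E2; case: (Z3_neq (typ y + 1)) => /negPf n1 /negPf n2 _.
  by case: (adj_typ hX htyp xz) => /esym/eqP; rewrite E1 E2 ?n1 ?n2.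
have hp' : reduced_path 1 p' by split=> [[|]|[|]].
by have [] := reduced_path_unique hp hp' erefl erefl.
Qed.

End Paths.

(** * The model triangle *)

Lemma mtypSl m n : mtyp (m.+1, n) = mtyp (m, n) + 1.
Proof. by rewrite /mtyp /= -natr1 addrAC. Qed.

Lemma mtypSr m n : mtyp (m, n.+1) = mtyp (m, n) - 1.
Proof. by rewrite /mtyp /= -natr1 opprD addrA. Qed.

Lemma mtypSS m n : mtyp (m.+1, n.+1) = mtyp (m, n).
Proof. by rewrite mtypSl mtypSr subrK. Qed.

Section Model.
Variable l : nat.

Definition code (c : mchamber l) : nat * nat * bool :=
  ((val c).1.1 : nat, (val c).1.2 : nat, (val c).2).

Lemma code_inj : injective code.
Proof.
case=> [[[x y] s] h] [[[x' y'] s'] h'] [] /= /ord_inj Ex /ord_inj Ey Es.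
by apply: val_inj; rewrite /= Ex Ey Es.
Qed.

(** The chambers at (m,n), which are all contained in the model triangle when
    (m,n) is not on its far side. *)
Definition star_codes (m n : nat) : seq (nat * nat * bool) :=
  (m, n, true)
  :: (if m is m'.+1 then [:: (m', n, false); (m', n, true)] else [::])
  ++ (if n is n'.+1 then [:: (m, n', true); (m, n', false)] else [::])
  ++ (if m is m'.+1 then if n is n'.+1 then [:: (m', n', false)] else [::]
      else [::]).

Lemma mchamber_code m n s : all (in_model l) (corners m n s) ->
  exists c : mchamber l, code c = (m, n, s).
Proof.
move=> h; have ml : (m < l)%N by case: s h; rewrite /= /in_model /=; lia.
have nl : (n < l)%N by case: s h {ml}; rewrite /= /in_model /=; lia.
by exists (Sub (Ordinal ml, Ordinal nl, s) h).
Qed.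

Lemma sum_star (R : nmodType) (m n : nat) (F : nat * nat * bool -> R) :
  (m + n < l)%N ->
  \sum_(c : mchamber l | (m, n) \in mcorners c) F (code c)
  = \sum_(t <- star_codes m n) F t.
Proof.
move=> mnl; rewrite -big_filter -(big_map code xpredT F).
apply/perm_big/uniq_perm.
- rewrite map_inj_uniq ?filter_uniq ?index_enum_uniq //; exact: code_inj.
- by case: m n {mnl} => [|m] [|n]; rewrite /= ?inE ?xpair_eqE /=; lia.
move=> [[m0 n0] s]; apply/mapP/idP.
- case=> c; rewrite mem_filter => /andP[]; rewrite /mcorners /code.
  case: (val c) => [[[x _] [y _]] s'] /= pc _ [-> -> ->] {m0 n0 s}.
  move: pc; rewrite /corners.
  by case: s'; case: m {mnl} => [|m]; case: n => [|n];
    rewrite /= ?inE ?xpair_eqE /=; lia.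
- move=> t_in.
  have : all (in_model l) (corners m0 n0 s) && ((m, n) \in corners m0 n0 s).
    by move: t_in; case: s; case: m mnl => [|m]; case: n => [|n] mnl;
      rewrite /corners /= /in_model ?inE ?xpair_eqE /=; lia.
  case/andP=> /mchamber_code[c Ec] pc; exists c; last by rewrite Ec.
  rewrite mem_filter mem_index_enum andbT /mcorners.
  by case: Ec => -> -> ->.
Qed.

Variables (q : nat) (E : 'M['Z_(delta q)]_(q.+1, 3)) (b a : seq 'Z_(delta q)).

(** Labels of positions (m, n, sign) rather than of chambers of the model
    triangle, so that no proof of membership is carried around. *)
Variable L : nat -> nat -> bool -> 'I_q.+1.

(** The labelling condition with both sums written out: up to six chambers
    around (m,n), and the labels of the two sides. *)
Definition star_condition : Prop := forall m n, (m + n < l)%N ->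
  let i := mtyp (m, n) in
  E (L m n true) i
  + (if m is m'.+1 then E (L m' n true) i - E (L m' n false) i else 0)
  + (if n is n'.+1 then E (L m n' true) i - E (L m n' false) i else 0)
  - (if m is m'.+1 then if n is n'.+1 then E (L m' n' false) i else 0 else 0)
  = (if n is 0%N then b`_m else 0) - (if m is 0%N then a`_n else 0).

End Model.

Lemma labeling_starP l q (E : 'M['Z_(delta q)]_(q.+1, 3))
    (b a : l.-tuple 'Z_(delta q)) (lam : mchamber l -> 'I_q.+1)
    (L : nat -> nat -> bool -> 'I_q.+1) :
  (forall c, lam c = L (code c).1.1 (code c).1.2 (code c).2) ->
  labeling_condition E b a lam <-> star_condition l E b a L.
Proof.
move=> EL.
have lhs m n : (m + n < l)%N ->
    \sum_(c : mchamber l | (m, n) \in mcorners c)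
        chamber_sign 'Z_(delta q) c * E (lam c) (mtyp (m, n))
    = \sum_(t <- star_codes m n) (if t.2 then 1 else -1)
         * E (L t.1.1 t.1.2 t.2) (mtyp (m, n)).
  move=> mnl; pose F (t : nat * nat * bool) :=
    (if t.2 then 1 else -1) * E (L t.1.1 t.1.2 t.2) (mtyp (m, n)).
  by rewrite -(sum_star F mnl); apply: eq_bigr => c _; rewrite EL.
have rhs m n : (m + n < l)%N ->
    \sum_(w <- out_edges l (m, n))
       edge_sign 'Z_(delta q) (m, n) w * edge_label b a (m, n) w
    = (if n is 0%N then b`_m else 0) - (if m is 0%N then a`_n else 0).
  move=> mnl; rewrite /out_edges /=.
  have -> : in_model l (m.+1, n) by rewrite /in_model /=; lia.
  have -> : in_model l (m, n.+1) by rewrite /in_model /=; lia.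
  have s1 : edge_sign 'Z_(delta q) (m, n) (m.+1, n) = 1.
    by rewrite /edge_sign mtypSl eqxx.
  have s2 : edge_sign 'Z_(delta q) (m, n) (m, n.+1) = -1.
    rewrite /edge_sign mtypSr eq_sym.
    by case: (Z3_neq (mtyp (m, n))) => _ _ /negPf->.
  rewrite !big_cons s1 s2 mul1r mulN1r.
  case: m {s1 s2} mnl => [|m] mnl; last first.
    rewrite /=; have -> : in_model l (m, n.+1) by rewrite /in_model /=; lia.
    by case: n mnl => [|n] _;
      rewrite big_cons big_nil /edge_label /= !mulr0 ?oppr0 !addr0.
  by case: n mnl => [|n] _; rewrite big_nil /edge_label /= addr0.
have star m n (i : 'Z_3) : \sum_(t <- star_codes m n)
       (if t.2 then 1 else -1) * E (L t.1.1 t.1.2 t.2) i =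
    E (L m n true) i
  + (if m is m'.+1 then E (L m' n true) i - E (L m' n false) i else 0)
  + (if n is n'.+1 then E (L m n' true) i - E (L m n' false) i else 0)
  - (if m is m'.+1 then if n is n'.+1 then E (L m' n' false) i else 0 else 0).
  case: m => [|m]; case: n => [|n];
    rewrite !big_cons big_nil /=; ring.
split=> h => [m n mnl i|[m n] /= mnl].
  by rewrite -rhs // -(h (m, n)) // lhs // star.
by rewrite lhs // rhs // star; apply: h.
Qed.

(** * Triangles with geodesic sides *)

Section Triangles.
Variables (V : choiceType) (K : {pred {fset V}}) (typ : V -> 'Z_3).
Hypotheses (hX : A2_building K) (htyp : type_function K typ).

Local Notation adj := (adj K).
Local Notation ch := (chamber K).

(** A path of length three between opposite vertices has no backtracking. *)
Lemma opposite_path3 y a b c d : opposite K y a d ->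
  ch y a b -> ch y b c -> ch y c d -> a <> c /\ b <> d.
Proof.
move=> o ab bc cd; split=> E.
  by apply: (opposite_chamberN o); rewrite E.
by apply: (opposite_chamberN o); rewrite -E.
Qed.

Section Immersed.
Variables (l : nat) (F : nat -> nat -> V).
Hypothesis pos_chamber : forall m n, (m + n < l)%N ->
  ch (F m n) (F m.+1 n) (F m n.+1).
Hypothesis neg_chamber : forall m n, (m + n.+1 < l)%N ->
  ch (F m.+1 n.+1) (F m.+1 n) (F m n.+1).
Hypothesis F_typ : forall m n, (m + n <= l)%N -> typ (F m n) = mtyp (m, n).
Hypotheses (bottom_geodesic : geodesic_path K l (F^~ 0%N))
  (left_geodesic : geodesic_path K l (F 0%N)).

Lemma bottom_fan m : (m.+1 < l)%N ->
  F m 0 <> F m.+1 1 /\ F m 1 <> F m.+2 0.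
Proof.
move=> ml; apply: opposite_path3 (proj2 bottom_geodesic m ml) _ _ _.
- have c : ch (F m 0) (F m.+1 0) (F m 1) by apply: pos_chamber; lia.
  by chamber_perm.
- have c : ch (F m.+1 1) (F m.+1 0) (F m 1) by apply: neg_chamber; lia.
  by chamber_perm.
- have c : ch (F m.+1 0) (F m.+2 0) (F m.+1 1) by apply: pos_chamber; lia.
  by chamber_perm.
Qed.

Lemma left_fan n : (n.+1 < l)%N -> F 1 n <> F 0 n.+2.
Proof.
move=> nl; have o := proj2 left_geodesic n nl.
apply: (proj2 (opposite_path3 (b := F 1 n) (c := F 1 n.+1) o _ _ _)).
- have c : ch (F 0 n) (F 1 n) (F 0 n.+1) by apply: pos_chamber; lia.
  by chamber_perm.
- have c : ch (F 1 n.+1) (F 1 n) (F 0 n.+1) by apply: neg_chamber; lia.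
  by chamber_perm.
- have c : ch (F 0 n.+1) (F 1 n.+1) (F 0 n.+2) by apply: pos_chamber; lia.
  by chamber_perm.
Qed.

Lemma hexagon m n : (m.+1 + n.+1 < l)%N ->
  let y := F m.+1 n.+1 in
  [/\ ch y (F m.+2 n) (F m.+1 n), ch y (F m.+1 n) (F m n.+1)
    & ch y (F m n.+1) (F m n.+2)] /\
  [/\ ch y (F m.+2 n) (F m.+2 n.+1), ch y (F m.+2 n.+1) (F m.+1 n.+2)
    & ch y (F m.+1 n.+2) (F m n.+2)].
Proof.
move=> mnl; split; split.
- have c : ch (F m.+1 n) (F m.+2 n) (F m.+1 n.+1) by apply: pos_chamber; lia.
  by chamber_perm.
- have c : ch (F m.+1 n.+1) (F m.+1 n) (F m n.+1) by apply: neg_chamber; lia.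
  by chamber_perm.
- have c : ch (F m n.+1) (F m.+1 n.+1) (F m n.+2) by apply: pos_chamber; lia.
  by chamber_perm.
- have c : ch (F m.+2 n.+1) (F m.+2 n) (F m.+1 n.+1) by apply: neg_chamber; lia.
  by chamber_perm.
- have c : ch (F m.+1 n.+1) (F m.+2 n.+1) (F m.+1 n.+2) by apply: pos_chamber; lia.
  by chamber_perm.
- have c : ch (F m.+1 n.+2) (F m.+1 n.+1) (F m n.+2) by apply: neg_chamber; lia.
  by chamber_perm.
Qed.

(** Induction on the distance from the base vertex: a star without folding towards 
    the base vertex has no folding away from it, because the path around the star
    towards the base vertex joins opposite vertices of the link, and the path on
    the other side of the star has the same ends. *)
Lemma upper_fan m n : (m + n.+1 < l)%N ->
  F m.+1 n <> F m n.+2 /\ F m.+2 n <> F m n.+1.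
Proof.
have [s] := ubnP (m + n); elim: s m n => // s IH m n mns mnl.
have step m' n' : (m' + n' < s)%N -> (m'.+1 + n'.+1 < l)%N ->
    F m'.+2 n' <> F m'.+1 n'.+2 /\ F m'.+2 n'.+1 <> F m' n'.+2.
  move=> lt_s lt_l; have lt_l' : (m' + n'.+1 < l)%N by lia.
  have [bd ac] := IH m' n' lt_s lt_l'.
  have [[ab bc cd] [ab' bc' cd']] := hexagon lt_l.
  have o := link_path3_opposite hX htyp ab bc cd ac bd.
  exact: opposite_path3 o ab' bc' cd'.
split.
  case: m mns mnl => [|m] mns mnl; first by apply: left_fan; lia.
  by apply: (proj1 (step m n _ _)); lia.
case: n mns mnl => [|n] mns mnl.
  by have [|_ /nesym//] := @bottom_fan m; lia.
by apply: (proj2 (step m n _ _)); lia.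
Qed.

(** The two chambers at an edge between vertices at the same distance from the
    base vertex do not coincide: a fold there would propagate along the row to
    the bottom side. *)
Lemma row_unfolded m n : (m + n.+1 < l)%N -> F m n <> F m.+1 n.+1.
Proof.
elim: n m => [|n IH] m mnl; first by apply: (proj1 (bottom_fan _)); lia.
have mnl' : (m.+1 + n.+1 < l)%N by lia.
have [[ab bc cd] [ab' bc' cd']] := hexagon mnl'.
have [|_ ac] := @upper_fan m n; first by lia.
move=> E; apply: (IH m.+1 mnl'); rewrite -E chamberC in bc'.
apply: (link_join_unique hX ac ab bc ab'); first by move: bc'; rewrite chamberC.
Qed.

Lemma vertical_opposite m n : (m + n.+1 < l)%N ->
  opposite K (F m n.+1) (F m n) (F m n.+2).
Proof.
move=> mnl; have [no_fold _] := upper_fan mnl.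
apply: (link_path3_opposite hX htyp _ _ _ (row_unfolded mnl) no_fold).
- have c : ch (F m n) (F m.+1 n) (F m n.+1) by apply: pos_chamber; lia.
  by chamber_perm.
- have c : ch (F m.+1 n.+1) (F m.+1 n) (F m n.+1) by apply: neg_chamber; lia.
  by chamber_perm.
- have c : ch (F m n.+1) (F m.+1 n.+1) (F m n.+2) by apply: pos_chamber; lia.
  by chamber_perm.
Qed.

(** Forward along the bottom side, then backward parallel to the left side: the
    shape of a normal form. *)
Definition corner_path (m k : nat) : V :=
  if (k <= m)%N then F k 0 else F m (k - m).

Lemma corner_path_end m n : corner_path m (m + n) = F m n.
Proof.
rewrite /corner_path; case: n => [|n]; first by rewrite addn0 leqnn.
by rewrite leqNgt addnS ltnS leq_addr /= -addnS addKn.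
Qed.

Lemma corner_path_reduced m n : (m + n <= l)%N ->
  reduced_path K typ (m + n) (corner_path m).
Proof.
move=> mnl.
have up j : (m + j < l)%N -> adj (F m j) (F m j.+1).
  by move=> h; have [_ _] := chamber_adj3 hX (pos_chamber h).
split=> k kmn.
  have [km|] := ltnP k m.
    by rewrite /corner_path km ltnW //; apply: (proj1 bottom_geodesic); lia.
  move=> mk; rewrite -(subnKC mk) -addnS !corner_path_end; apply: up; lia.
have [kml|] := ltnP k.+1 m.
  rewrite /corner_path kml (ltnW kml) (ltnW (ltnW kml)).
  by apply: (proj2 (geodesic_reduced hX htyp bottom_geodesic)); lia.
rewrite leq_eqVlt => /orP[/eqP Em|]; last first.
  rewrite ltnS => mk; rewrite -(subnKC mk) -!addnS !corner_path_end.
  apply: (opposite_reduced hX htyp); last by apply: vertical_opposite; lia.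
    by apply: up; lia.
  by apply: up; lia.
have -> : corner_path m k = F k 0 by rewrite /corner_path Em leqnSn.
have -> : corner_path m k.+1 = F k.+1 0 by rewrite /corner_path Em leqnn.
have -> : corner_path m k.+2 = F k.+1 1.
  by rewrite /corner_path Em ltnn subSn // subnn.
have t0 : typ (F k 0) = mtyp (k, 0%N) by apply: F_typ; lia.
have t2 : typ (F k.+1 1) = mtyp (k, 0%N) by rewrite F_typ ?mtypSS //; lia.
split.
- by apply: row_unfolded; lia.
- by rewrite chamberC => /(chamber_typ_neq htyp); rewrite t0 t2 eqxx.
- have -> : typ (F k.+1 0) = mtyp (k, 0%N) + 1 by rewrite F_typ ?mtypSl //; lia.
  rewrite t0 => -[/eqP]; rewrite Z3_add2.
  by case: (Z3_neq (mtyp (k, 0%N))) => _; rewrite eq_sym => /negPf->.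
Qed.

(** The image of a vertex determines the normal form of the paths to it, and the
    numbers of forward and backward edges of this path are its coordinates. *)
Lemma immersed_injective m n m' n' : (m + n <= l)%N -> (m' + n' <= l)%N ->
  F m n = F m' n' -> m = m' /\ n = n'.
Proof.
have lt_absurd a b a' b' : (a + b <= l)%N -> (a' + b' <= l)%N -> (a < a')%N ->
    F a b <> F a' b'.
  move=> ab ab' aa'; rewrite -!corner_path_end => Eend.
  have [Es Ek] := reduced_path_unique hX htyp (corner_path_reduced ab)
    (corner_path_reduced ab') (erefl (F 0 0)) Eend.
  (* The step from position a to a + 1 is backward in one path and forward in the
     other. *)
  have Ea : F a 1 = F a.+1 0.
    have := Ek a.+1; rewrite /corner_path ltnn aa' subSnn; apply; lia.
  have := congr1 typ Ea; rewrite !F_typ; try lia.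
  rewrite mtypSl mtypSr => /esym/eqP.
  by case: (Z3_neq (mtyp (a, 0%N))) => _ _ /negPf->.
move=> mn mn' E; case: (ltngtP m m') => [/lt_absurd|/lt_absurd|Em].
- by move/(_ n n' mn mn')/(_ E).
- by move/(_ n' n mn' mn)/(_ (esym E)).
split=> //; subst m'; rewrite -!corner_path_end in E.
have [Es _] := reduced_path_unique hX htyp (corner_path_reduced mn)
    (corner_path_reduced mn') (erefl (F 0 0)) E.
by move/addnI: Es.
Qed.

End Immersed.

(** Conversely the sides of an embedded triangle are geodesic, because a path of
    length three without backtracking in the link joins opposite vertices. *)
Lemma embedded_bottom_geodesic l (F : nat -> nat -> V) :
  (forall m n, (m + n < l)%N -> ch (F m n) (F m.+1 n) (F m n.+1)) ->
  (forall m n, (m + n.+1 < l)%N -> ch (F m.+1 n.+1) (F m.+1 n) (F m n.+1)) ->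
  (forall m n m' n', (m + n <= l)%N -> (m' + n' <= l)%N ->
     F m n = F m' n' -> (m, n) = (m', n')) ->
  geodesic_path K l (F^~ 0%N).
Proof.
move=> pos neg inj; split=> k kl.
  by apply: (chamber_adj hX (pos k 0%N _)); lia.
have c1 : ch (F k 0) (F k.+1 0) (F k 1) by apply: pos; lia.
have c2 : ch (F k.+1 1) (F k.+1 0) (F k 1) by apply: neg; lia.
have c3 : ch (F k.+1 0) (F k.+2 0) (F k.+1 1) by apply: pos; lia.
apply: (link_path3_opposite hX htyp (b := F k 1) (c := F k.+1 1)).
- by chamber_perm.
- by chamber_perm.
- by chamber_perm.
- by move=> E; have /(congr1 snd) : (k, 0%N) = (k.+1, 1%N) by apply: inj E; lia.
- by move=> E; have /(congr1 snd) : (k, 1%N) = (k.+2, 0%N) by apply: inj E; lia.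
Qed.

Lemma embedded_left_geodesic l (F : nat -> nat -> V) :
  (forall m n, (m + n < l)%N -> ch (F m n) (F m.+1 n) (F m n.+1)) ->
  (forall m n, (m + n.+1 < l)%N -> ch (F m.+1 n.+1) (F m.+1 n) (F m n.+1)) ->
  (forall m n m' n', (m + n <= l)%N -> (m' + n' <= l)%N ->
     F m n = F m' n' -> (m, n) = (m', n')) ->
  geodesic_path K l (F 0%N).
Proof.
move=> pos neg inj.
apply: (embedded_bottom_geodesic (F := fun m n => F n m))
  => [m n h|m n h|m n m' n' h h' E].
- by rewrite chamberC; apply: pos; lia.
- by rewrite chamberC; apply: neg; lia.
- by have [-> ->] : (n, m) = (n', m') by apply: inj E; lia.
Qed.

Lemma regular_triangleP l (f : nat * nat -> V) :
  regular_triangle K l f <->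
  [/\ forall m n, (m + n < l)%N -> ch (f (m, n)) (f (m.+1, n)) (f (m, n.+1)),
      forall m n, (m + n.+1 < l)%N ->
        ch (f (m.+1, n.+1)) (f (m.+1, n)) (f (m, n.+1))
    & {in in_model l &, injective f}].
Proof.
have im a b c : [fset f p | p in [:: a; b; c]] = [fset f a; f b; f c].
  apply/fsetP=> t; rewrite !inE; apply/imfsetP/idP => [[p /=]|].
    by rewrite !inE => /or3P[] /eqP-> ->; rewrite eqxx ?orbT.
  by rewrite -orbA => /or3P[] /eqP->; [exists a|exists b|exists c];
    rewrite //= !inE eqxx ?orbT.
split=> [[inj hK]|[pos neg inj]]; split=> //.
- move=> m n mnl; have [|c Ec] := @mchamber_code l m n true.
    by rewrite /= /in_model /=; lia.
  have := hK c; rewrite /mcorners; case: Ec => -> -> ->.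
  rewrite /corners im chamberE => ->; rewrite !(inj_in_eq inj);
    by rewrite ?unfold_in /in_model ?xpair_eqE /=; lia.
- move=> m n mnl; have [|c Ec] := @mchamber_code l m n false.
    by rewrite /= /in_model /=; lia.
  have := hK c; rewrite /mcorners; case: Ec => -> -> ->.
  rewrite /corners im chamberR chamberE => ->; rewrite !(inj_in_eq inj);
    by rewrite ?unfold_in /in_model ?xpair_eqE /=; lia.
- move=> [[[m n] s] h]; rewrite /mcorners /= in h *.
  case: s h => /= h; rewrite im.
    by have : ch (f (val m, val n)) (f ((val m).+1, val n)) (f (val m, (val n).+1));
      [apply: pos; move: h; rewrite /in_model /=; lia | rewrite chamberE => /and4P[]].
  have : ch (f ((val m).+1, (val n).+1)) (f ((val m).+1, val n))
      (f (val m, (val n).+1)).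
    by apply: neg; move: h; rewrite /in_model /=; lia.
  by rewrite chamberR chamberE => /and4P[].
Qed.

End Triangles.

(** * Difference sets and powers modulo the order *)

(** Taking differences is a bijection from the pairs of distinct elements of D to
    the nonzero residues. *)
Lemma card_difference_set n (D : {set 'Z_n}) : (1 < n)%N ->
  difference_set D -> (#|D| ^ 2 = n.-1 + #|D|)%N.
Proof.
move=> n1 hD; pose X := [set p : 'Z_n * 'Z_n | p.1 != p.2].
have imX : [set p.1 - p.2 | p in setX D D :&: X] = [set~ 0].
  apply/setP=> x; rewrite !inE; apply/imsetP/idP => [[[a b]]|x0].
    by rewrite !inE /= => /andP[_ ab] ->; rewrite subr_eq0.
  have [[a b] [[/= aD bD Ex] _]] := hD x x0.
  by exists (a, b) => //; rewrite !inE /= aD bD -subr_eq0 -Ex.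
have cX : #|setX D D :&: X| = n.-1.
  rewrite -(card_in_imset (f := fun p => p.1 - p.2)).
    by rewrite imX cardsC1 card_ord Zp_cast.
  move=> p p'; rewrite !inE => /andP[/andP[p1 p2] np] /andP[/andP[p1' p2'] _] E.
  have [|r [_ ru]] := hD (p.1 - p.2); first by rewrite subr_eq0.
  by rewrite -(ru p) ?(ru p').
have cD : #|setX D D :\: X| = #|D|.
  rewrite -(card_imset (mem D) (f := fun a => (a, a))); last by move=> a b [].
  apply: eq_card => -[a b]; rewrite !inE /= negbK; apply/idP/imsetP.
    by case/and3P=> /eqP <- aD _; exists a.
  by case=> c cD [-> ->]; rewrite eqxx cD.
by rewrite -mulnn -cardsX -(cardsID X) cX cD.
Qed.

Section Zpow.
Variables (G : groupType) (x : G) (d : nat).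
Hypotheses (d1 : (1 < d)%N) (xd : (x ^+ d)%g = 1%g).

Lemma expg_modn n : (x ^+ (n %% d))%g = (x ^+ n)%g.
Proof. by rewrite [in RHS](divn_eq n d) expgnDr mulnC expgnA xd expg1n mul1g. Qed.

Lemma expgZD (a b : 'Z_d) : (x ^+ (a + b)%R)%g = (x ^+ a * x ^+ b)%g.
Proof.
rewrite -expgnDr -(expg_modn (a + b)); congr (_ ^+ _)%g.
by congr (_ %% _)%N; apply: Zp_cast.
Qed.

Lemma expgZN (a : 'Z_d) : (x ^+ (- a)%R)%g = (x ^+ a)^-1%g.
Proof. by apply/esym/mulg1_eq; rewrite -expgZD subrr. Qed.

Lemma expgZ_gen n : exists a : 'Z_d, (x ^+ n = x ^+ a)%g.
Proof. by exists (inZp n); rewrite /= Zp_cast // expg_modn. Qed.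

Lemma cyclic_gen_expgZ g : cyclic_gen x g -> exists a : 'Z_d, (g = x ^+ a)%g.
Proof.
case=> n [->|->]; have [a ->] := expgZ_gen n; first by exists a.
by exists (- a); rewrite expgZN.
Qed.

End Zpow.

(** * Singer cyclic lattices *)

Section Action.
Variables (q : nat) (V : choiceType) (K : {pred {fset V}}) (typ : V -> 'Z_3).
Variables (G : groupType) (act : G -> V -> V).
Hypothesis hG : singer_cyclic_lattice q K typ act.

Local Notation adj := (adj K).
Local Notation ch := (chamber K).

Let hX := scl_building hG.
Let htyp := scl_typ hG.
Let hact := scl_action hG.

Lemma actM g h x : act (g * h)%g x = act g (act h x).
Proof. exact: act_mul hact g h x. Qed.

Lemma act1 x : act 1%g x = x.
Proof. exact: act_one hact x. Qed.

Lemma typ_act g x : typ (act g x) = typ x.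
Proof. exact: act_typ hact g x. Qed.

Lemma actK g x : act g^-1%g (act g x) = x.
Proof. by rewrite -actM mulVg act1. Qed.

Lemma act_inj g : injective (act g).
Proof. exact: can_inj (actK g). Qed.

Lemma act_chamber g x y z : ch (act g x) (act g y) (act g z) = ch x y z.
Proof.
have h g' x' y' z' : ch x' y' z' -> ch (act g' x') (act g' y') (act g' z').
  rewrite !chamberE !(inj_eq (@act_inj g')) => /and4P[-> -> -> xyzK] /=.
  have := act_simplex hact g' xyzK.
  rewrite (_ : [fset act g' x | x in _] = [fset act g' x'; act g' y'; act g' z']) //.
  by rewrite imfsetU imfset_fset1 imfset_fset2.
by apply/idP/idP => [/(h g^-1%g)|/h//]; rewrite !actK.
Qed.

Lemma act_adj g x y : adj (act g x) (act g y) = adj x y.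
Proof.
have h g' x' y' : adj x' y' -> adj (act g' x') (act g' y').
  rewrite /Defs.adj (inj_eq (@act_inj g')) => /andP[-> xyK] /=.
  have := act_simplex hact g' xyK.
  rewrite (_ : [fset act g' x | x in _] = [fset act g' x'; act g' y']) //.
  by rewrite imfset_fset2.
by apply/idP/idP => [/(h g^-1%g)|/h//]; rewrite !actK.
Qed.

Lemma act_transitive x y x' y' : adj x y -> adj x' y' ->
  typ x = typ x' -> typ y = typ y' -> exists g, act g x = x' /\ act g y = y'.
Proof.
move=> xy xy' Ex Ey.
have tne : typ x != typ y.
  by have [z] := adj_chamber hX xy; apply: chamber_typ_neq.
case/andP: (xy) (xy') => nxy xyK /andP[nxy' xyK'].
have [|||g [Eg _]] := scl_regular hG xyK xyK'.
- by rewrite cardfs2 nxy.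
- by rewrite cardfs2 nxy'.
- by rewrite /simplex_type !imfset_fset2 Ex Ey.
exists g; move: Eg; rewrite imfset_fset2 => /fsetP Eg.
have : act g x \in [fset x'; y'] by rewrite -Eg !inE eqxx.
have : act g y \in [fset x'; y'] by rewrite -Eg !inE eqxx orbT.
rewrite !inE => /orP[/eqP E|/eqP ->] /orP[/eqP ->|/eqP E'] //.
- by case/eqP: tne; rewrite Ex -E typ_act.
- by case/eqP: tne; rewrite Ex -E typ_act.
- by case/eqP: tne; rewrite Ey -E' typ_act.
Qed.

Lemma act_free g x y : adj x y -> act g x = x -> act g y = y -> g = 1%g.
Proof.
case/andP=> nxy xyK Ex Ey.
have c : #|` [fset x; y]| = 2 by rewrite cardfs2 nxy.
have [h [_ hu]] := scl_regular hG xyK xyK c c erefl.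
rewrite -(hu g) ?(hu 1%g) //; rewrite imfset_fset2 ?act1 ?Ex ?Ey //.
Qed.

End Action.

(** * Presenting triples *)

Section Presentation.
Variables (q : nat) (V : choiceType) (K : {pred {fset V}}) (typ : V -> 'Z_3).
Variables (G : groupType) (act : G -> V -> V) (sigma : 'Z_3 -> G).
Variables (E : 'M['Z_(delta q)]_(q.+1, 3)) (v : 'Z_3 -> V).
Hypotheses (hq : (0 < q)%N) (hG : singer_cyclic_lattice q K typ act).
Hypotheses (hE : presenting_triple sigma E) (hv : base_chamber K typ act sigma v).

Local Notation adj := (adj K).
Local Notation ch := (chamber K).

Let hX := scl_building hG.
Let htyp := scl_typ hG.

Lemma delta_gt1 : (1 < delta q)%N.
Proof. by rewrite /delta; lia. Qed.

(** The rotations about v_i; exponents are read modulo delta. *)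
Definition rot (i : 'Z_3) (n : 'Z_(delta q)) : G := (sigma i ^+ n)%g.

(** ** Consequences of the presentation *)

Lemma eval_gen_pow i n : eval_word sigma (gen_pow i n) = (sigma i ^+ n)%g.
Proof.
elim: n => [|n IH]; first by rewrite /eval_word big_nil.
by rewrite /eval_word big_cons expgS /= -IH.
Qed.

Lemma eval_relator w : singer_relator E w -> eval_word sigma w = 1%g.
Proof.
move=> hw; have [_ [_ pres]] := hE.
have -> : 1%g = eval_word sigma [::] by rewrite /eval_word big_nil.
by apply/pres; have := pe_relator [::] [::] hw; rewrite /= cats0.
Qed.

Lemma sigma_order i : (sigma i ^+ delta q)%g = 1%g.
Proof. by rewrite -eval_gen_pow; apply/eval_relator/rel_order. Qed.

Lemma row_relation j i :
  (rot i (E j i) * rot (i + 1)%R (E j (i + 1)%R)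
     * rot (i - 1)%R (E j (i - 1)%R))%g = 1%g.
Proof.
have rel : (rot 0%R (E j 0%R) * rot 1%R (E j 1%R) * rot 2%:R (E j 2%:R))%g = 1%g.
  rewrite /rot -!eval_gen_pow -(eval_relator (rel_row E j)) /eval_word.
  by rewrite !big_cat /= mulgA.
have turn (x y z : G) : (x * y * z = 1 -> y * z * x = 1)%g.
  by rewrite -mulgA => /mulg1_eq <-; rewrite mulVg.
have [e1 e2 e3 e4 e5] : [/\ 0 + 1 = 1 :> 'Z_3, 0 - 1 = 2%:R :> 'Z_3,
    1 + 1 = 2%:R :> 'Z_3, 2%:R + 1 = 0 :> 'Z_3 & 2%:R - 1 = 1 :> 'Z_3].
  by split; apply/eqP.
case: (Z3P i) => ->; rewrite ?e1 ?e2 ?e3 ?e4 ?e5 ?subrr //; first exact: turn rel.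
exact/turn/turn/rel.
Qed.

Lemma rotD i a b : rot i (a + b) = (rot i a * rot i b)%g.
Proof. exact: expgZD delta_gt1 (sigma_order i) a b. Qed.

Lemma rot0 i : rot i 0 = 1%g.
Proof. by []. Qed.

Lemma rotN i a : rot i (- a) = (rot i a)^-1%g.
Proof. exact: expgZN delta_gt1 (sigma_order i) a. Qed.

Lemma act_rot i n : act (rot i n) (v i) = v i.
Proof. by apply/(bc_stab hv); exists (n : nat); left. Qed.

Lemma stab_rot i g : act g (v i) = v i -> exists n, g = rot i n.
Proof. by move/(bc_stab hv)/(cyclic_gen_expgZ delta_gt1 (sigma_order i)). Qed.

Lemma v_chamber i : ch (v i) (v (i + 1)) (v (i - 1)).
Proof.
have c := bc_chamber hv.
have [e1 e2 e3 e4 e5] : [/\ 0 + 1 = 1 :> 'Z_3, 0 - 1 = 2%:R :> 'Z_3,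
    1 + 1 = 2%:R :> 'Z_3, 2%:R + 1 = 0 :> 'Z_3 & 2%:R - 1 = 1 :> 'Z_3].
  by split; apply/eqP.
by case: (Z3P i) => ->; rewrite ?e1 ?e2 ?e3 ?e4 ?e5 ?subrr //; chamber_perm.
Qed.

Lemma v_adj i k : i != k -> adj (v i) (v k).
Proof.
by have [a _ b] := chamber_adj3 hX (v_chamber i); case/Z3_other=> ->.
Qed.

Lemma neighbour g i y : adj (act g (v i)) y ->
  exists n, y = act (g * rot i n)%g (v (typ y)).
Proof.
move=> giy; have ty : i != typ y.
  have [z] := adj_chamber hX giy => /(chamber_typ_neq htyp).
  by rewrite (typ_act hG) (bc_typ hv).
have giy' : adj (v i) (act g^-1%g y) by rewrite -(actK hG g (v i)) (act_adj hG).
have [||h [h1 h2]] := act_transitive hG (v_adj ty) giy' => //.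
  by rewrite (typ_act hG) (bc_typ hv).
have [n En] := stab_rot h1; exists n.
by rewrite (actM hG) -En h2 -(actM hG) mulgV (act1 hG).
Qed.

Lemma sigma_free i k n : i != k -> act (sigma i ^+ n)%g (v k) = v k ->
  (sigma i ^+ n)%g = 1%g.
Proof.
move=> ik Ek; apply: (act_free hG (v_adj ik)) => //.
by apply/(bc_stab hv); exists n; left.
Qed.

(** ** The order of the generators *)

Section Order.
Variables (i : 'Z_3) (d : nat).
Hypotheses (d1 : (1 < d)%N) (sd : (sigma i ^+ d)%g = 1%g).
(** Here d is the exact order of the generator, of which only the divisibility
    of delta by it is known so far. *)
Hypothesis dmin : forall n : 'Z_d, (sigma i ^+ n)%g = 1%g -> n = 0.

(** Identify the points of the link of v_i with Z/d. This is then the line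
    v_(i-1). *)
Definition link_set : {set 'Z_d} :=
  [set n : 'Z_d | ch (v i) (act (sigma i ^+ n)%g (v (i + 1))) (v (i - 1))].

Let ne_p : i != i + 1. Proof. by case: (Z3_neq i); rewrite eq_sym. Qed.
Let ne_m : i != i - 1. Proof. by case: (Z3_neq i) => _; rewrite eq_sym. Qed.

Lemma sigma_pow_inj k (m n : 'Z_d) : i != k ->
  act (sigma i ^+ m)%g (v k) = act (sigma i ^+ n)%g (v k) -> m = n.
Proof.
move=> ik Emn; apply/eqP; rewrite -subr_eq0; apply/eqP/dmin.
apply: sigma_free ik _; rewrite (addrC m) (expgZD d1 sd) (expgZN d1 sd) (actM hG) Emn.
by rewrite (actK hG).
Qed.

Lemma neighbour_pow y : adj (v i) y ->
  exists n : 'Z_d, y = act (sigma i ^+ n)%g (v (typ y)).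
Proof.
rewrite -{1}(act1 hG (v i)) => /neighbour[n ->].
have [m Em] := expgZ_gen d1 sd n; exists m.
by rewrite mul1g (typ_act hG) (bc_typ hv) /rot Em.
Qed.

Lemma act_sigma (n : 'Z_d) : act (sigma i ^+ n)%g (v i) = v i.
Proof. by apply/(bc_stab hv); exists (n : nat); left. Qed.

(** Two points of the link lie on exactly one line, and the powers of the
    generator act simply transitively on the points and on the lines. *)
Lemma link_set_difference : difference_set link_set.
Proof.
move=> x x0; pose p := v (i + 1); pose p' := act (sigma i ^+ x)%g p.
have linkE (m n : 'Z_d) :
    ch (v i) (act (sigma i ^+ m)%g p) (act (sigma i ^+ n)%g (v (i - 1)))
    = (m - n \in link_set).
  rewrite inE (addrC m) (expgZD d1 sd) (expgZN d1 sd).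
  by rewrite -[RHS](act_chamber hG (sigma i ^+ n)%g) -(actM hG) mulVKg act_sigma.
have pp' : p <> p'.
  move=> Epp; case/eqP: x0; apply/dmin/(sigma_free ne_p); exact/esym.
have tp : typ p = typ p' by rewrite (typ_act hG).
have ip : adj (v i) p by apply: v_adj.
have ip' : adj (v i) p' by rewrite -(act_sigma x) (act_adj hG).
(* The line w through p and its translate p' is itself a translate of v_(i-1). *)
have [w pw wp'] := link_join hX htyp ip ip' tp pp'.
have tw : typ w = i - 1.
  by rewrite (chamber_typ_eq htyp pw) ?(bc_typ hv).
have iw : adj (v i) w by case/chamber_adj3: wp'.
have [m Em] := neighbour_pow iw.
rewrite tw in Em.
exists (x - m, - m); split=> /=.
  split; last by rewrite opprK subrK.
    by rewrite -linkE -Em chamberC.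
  by rewrite -[- m]add0r -linkE -Em (act1 hG).
case=> a b /= [a_in b_in Ex].
have [pw' wp''] : ch (v i) p (act (sigma i ^+ (- b)%R)%g (v (i - 1))) /\
    ch (v i) (act (sigma i ^+ (- b)%R)%g (v (i - 1))) p'.
  split; first by rewrite -{1}(act1 hG p) (linkE 0) opprK add0r.
  by rewrite chamberC linkE opprK Ex subrK.
have Emb : m = - b.
  apply: (sigma_pow_inj ne_m).
  by rewrite -Em (link_join_unique hX pp' pw wp' pw' wp'').
by rewrite Emb Ex !opprK subrK.
Qed.

(** The elements correspond to the q + 1 chambers containing v_i and v_(i-1). *)
Lemma card_link_set : #|link_set| = q.+1.
Proof.
have := v_chamber i; rewrite chamberC => im.
have := chamber_adj hX im => /andP[nim imK].
have [|A [cardA inA]] := scl_order hG imK; first by rewrite cardfs2 nim.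
pose F (n : 'Z_d) := [fset v i; v (i - 1); act (sigma i ^+ n)%g (v (i + 1))].
have FA : [seq F n | n <- enum link_set] =i A.
  move=> s; apply/mapP/idP => [[n]|].
    rewrite mem_enum inE chamberC => c ->; apply/inA; split.
    - by move: c; rewrite chamberE => /and4P[].
    - exact: chamber_card c.
    - by apply/fsubsetP=> t; rewrite !inE => ->.
  case/inA=> sK cs /(edge_third (chamber_adj hX im) sK cs)[y c ->].
  have ty : typ y = i + 1.
    by rewrite (chamber_typ_eqN htyp c) !(bc_typ hv).
  have [_ _ iya] := chamber_adj3 hX c.
  have [n En] := neighbour_pow iya; rewrite ty in En.
  by exists n; [rewrite mem_enum inE -En chamberC | rewrite /F -En].
have Finj : {in link_set &, injective F}.
  move=> m n mD nD Emn; apply: (sigma_pow_inj ne_p).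
  have : act (sigma i ^+ m)%g (v (i + 1)) \in F n by rewrite -Emn !inE eqxx orbT.
  have ta : typ (act (sigma i ^+ m)%g (v (i + 1))) = i + 1.
    by rewrite (typ_act hG) (bc_typ hv).
  rewrite !inE -orbA => /or3P[] /eqP Ea //; move: ta; rewrite Ea (bc_typ hv).
    by move/eqP; rewrite (negPf ne_p).
  by move/eqP; case: (Z3_neq i) => _ _; rewrite eq_sym => /negPf->.
rewrite -cardA cardE -(size_map F); apply: (perm_size (uniq_perm _ _ FA)).
  rewrite map_inj_in_uniq ?enum_uniq // => m n.
  by rewrite !mem_enum; apply: Finj.
exact: fset_uniq.
Qed.

End Order.

(** Counting a difference set with q + 1 elements modulo the order d gives
    (q + 1)^2 = (d - 1) + (q + 1), so d is delta. *)
Lemma sigma_order_min i (n : 'Z_(delta q)) : (sigma i ^+ n)%g = 1%g -> n = 0.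
Proof.
have ex : exists d, (0 < d)%N && (sigma i ^+ d == 1)%g.
  by exists (delta q); rewrite sigma_order eqxx (ltn_trans _ delta_gt1).
case: (ex_minnP ex) => d /andP[d0 /eqP sd] dmin.
(* If sigma_i were trivial, v_(i+1) would be the only neighbour of its type. *)
have d1 : (1 < d)%N.
  case: d sd d0 {dmin} => [|[|d]] // sd _; have := v_chamber i; rewrite chamberC => im.
  have := chamber_adj hX im => ima; have /andP[nim imK] := ima.
  have [|A [cardA inA]] := scl_order hG imK; first by rewrite cardfs2 nim.
  suff /fsubset_leq_card : A `<=` [fset [fset v i; v (i - 1); v (i + 1)]].
    by rewrite cardA cardfs1 ltnS leqNgt hq.
  apply/fsubsetP=> s /inA[sK cs /(edge_third ima sK cs)[y c ->]].
  have ty : typ y = i + 1 by rewrite (chamber_typ_eqN htyp c) !(bc_typ hv).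
  have [_ _ iy] := chamber_adj3 hX c; rewrite -(act1 hG (v i)) in iy.
  have [m] := neighbour iy.
  by rewrite ty mul1g /rot -[sigma i]expg1 sd expg1n (act1 hG) => ->; rewrite inE.
have dmin' (m : 'Z_d) : (sigma i ^+ m)%g = 1%g -> m = 0.
  move=> sm; apply/eqP; rewrite -(inj_eq val_inj) /= -leqn0 leqNgt.
  apply/negP=> m0; have := dmin m; rewrite m0 sm eqxx => /(_ isT).
  by rewrite leqNgt -[X in (_ < X)%N](Zp_cast d1) ltn_ord.
have := card_difference_set d1 (link_set_difference d1 sd dmin').
rewrite card_link_set // => Ed.
move: n; rewrite (_ : delta q = d) //.
by move: Ed; rewrite /delta; case: (d) d0 => // d' _ /=; lia.
Qed.

(** The relator of row j says that v_i, v_(i-1) and the vertex with label E j i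
    are pairwise adjacent, so they span a chamber by the flag property. The column
    has q + 1 entries, and there are no more chambers at this edge. *)
Lemma chamber_row i n :
  ch (v i) (act (rot i n) (v (i + 1))) (v (i - 1)) <-> exists j, E j i = n.
Proof.
pose D := link_set i (delta q).
have sub : column_set E i \subset D.
  apply/subsetP=> _ /imsetP[j _ ->]; rewrite inE; set r := rot i (E j i).
  have [n1 n2 n3] := Z3_neq i.
  apply: (flag hX htyp); last by rewrite v_adj 1?eq_sym.
    by rewrite -(act_rot i (E j i)) (act_adj hG) v_adj // eq_sym.
  have -> : v (i - 1) = act r (act (rot (i + 1) (E j (i + 1))) (v (i - 1))).
    rewrite -(actM hG) -[in LHS](act1 hG (v (i - 1))) -(row_relation j i).
    by rewrite [in LHS](actM hG) act_rot.
  by rewrite (act_adj hG) -{1}(act_rot (i + 1) (E j (i + 1))) (act_adj hG) v_adj.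
have cD : #|D| = q.+1 :=
  card_link_set delta_gt1 (sigma_order i) (@sigma_order_min i).
(* The cardinality c satisfies c^2 - c = q^2 + q. *)
have cE : #|column_set E i| = q.+1.
  have := card_difference_set delta_gt1 (proj1 (proj1 hE) i).
  by rewrite /delta; nia.
have ED : column_set E i = D by apply/eqP; rewrite eqEcard sub cD cE leqnn.
have -> : ch (v i) (act (rot i n) (v (i + 1))) (v (i - 1)) = (n \in D) by rewrite inE.
rewrite -ED; split=> [/imsetP[j _ ->]|[j <-]]; [by exists j | exact: imset_f].
Qed.

(** ** Frames and rows of chambers *)

(** An element g is regarded as a frame at the vertex act g (v i). It labels the
    neighbours of each type k by Z/delta; this is the neighbour with label n.
    Multiplying g by a rotation about v_i shifts all labels at this vertex. *)
Definition nb (g : G) (i k : 'Z_3) (n : 'Z_(delta q)) : V := act (g * rot i n)%g (v k).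

Lemma nb_inj g i k m n : i != k -> nb g i k m = nb g i k n -> m = n.
Proof.
move=> ik; rewrite /nb !(actM hG) => /(act_inj hG).
exact: (sigma_pow_inj delta_gt1 (sigma_order i) (@sigma_order_min i)).
Qed.

Lemma nb0 g i k : nb g i k 0 = act g (v k).
Proof. by rewrite /nb rot0 mulg1. Qed.

Lemma nb_shift g i k a n : nb (g * rot i a)%g i k n = nb g i k (a + n).
Proof. by rewrite /nb -mulgA rotD. Qed.

Lemma act_rot_v g i n : act (g * rot i n)%g (v i) = act g (v i).
Proof. by rewrite (actM hG) act_rot. Qed.

(** The chamber x, y, z, with x of type i and y of type i + 1, is a translate of
    the chamber of row j. In the frame g the labels of y and z are 0 and - E j i;
    in every frame at x their difference is E j i. *)
Definition row_label (j : 'I_q.+1) (i : 'Z_3) (x y z : V) : Prop :=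
  exists g, [/\ x = act g (v i), y = act g (v (i + 1))
              & z = nb g i (i - 1) (- E j i)].

Lemma row_label_intro j i g m n : n - m = E j i ->
  row_label j i (act g (v i)) (nb g i (i + 1) n) (nb g i (i - 1) m).
Proof.
move=> Enm; exists (g * rot i n)%g; split=> //; first by rewrite act_rot_v.
by rewrite nb_shift -Enm opprB (addrC n) subrK.
Qed.

Lemma row_label_frame j i g y z : row_label j i (act g (v i)) y z ->
  exists n, y = nb g i (i + 1) n /\ z = nb g i (i - 1) (n - E j i).
Proof.
case=> h [Eg -> ->].
have [n En] : exists n, (g^-1 * h)%g = rot i n.
  by apply: stab_rot; rewrite (actM hG) -Eg (actK hG).
have -> : h = (g * rot i n)%g by rewrite -En mulVKg.
by exists n; rewrite nb_shift.
Qed.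

Lemma row_label_neg j i g n z :
  row_label j i (act g (v i)) (nb g i (i + 1) n) z ->
  z = nb g i (i - 1) (n - E j i).
Proof.
have [n1 _ _] := Z3_neq i.
by case/row_label_frame=> m [/nb_inj-> //]; rewrite eq_sym.
Qed.

Lemma row_label_pos j i g m y :
  row_label j i (act g (v i)) y (nb g i (i - 1) m) ->
  y = nb g i (i + 1) (m + E j i).
Proof.
have [_ n2 _] := Z3_neq i.
by case/row_label_frame=> n [-> /nb_inj->]; rewrite ?subrK // eq_sym.
Qed.

(** The defining relation of a row is invariant under cyclic permutation, so
    the label of a chamber does not depend on the vertex it is read from. *)
Lemma row_label_turn j i x y z : row_label j i x y z -> row_label j (i + 1) y z x.
Proof.
case=> g [-> -> ->]; exists (g * rot (i + 1) (E j (i + 1)))%g.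
rewrite act_rot_v Z3_add2 nb_shift subrr nb0 addrK; split=> //.
rewrite /nb !(actM hG); congr (act g).
have := row_relation j i; rewrite -mulgA => /mulg1_eq; rewrite -rotN => ->.
by rewrite (actM hG) act_rot.
Qed.

Lemma row_label_turn2 j i x y z : row_label j i x y z -> row_label j (i - 1) z x y.
Proof. by move/row_label_turn/row_label_turn; rewrite Z3_add2. Qed.

Lemma row_label_chamber j i x y z : row_label j i x y z -> ch x y z.
Proof.
case=> g [-> -> ->].
have /(chamber_row i) c : exists j', E j' i = E j i by exists j.
rewrite /nb (actM hG) (act_chamber hG) -(act_chamber hG (rot i (E j i))) act_rot.
by rewrite -(actM hG) rotN mulgV (act1 hG).
Qed.

(** A frame at x in which z has label 0 exists by transitivity on edges. *)
Lemma row_label_exists i x y z : ch x y z -> typ x = i -> typ y = i + 1 ->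
  exists j, row_label j i x y z.
Proof.
move=> c tx ty; have [n1 n2 n3] := Z3_neq i.
have tz : typ z = i - 1 by rewrite -tx (chamber_typ_eq htyp c) // tx.
have [xy _ xz] := chamber_adj3 hX c.
have [|||g [Ex Ez]] := act_transitive hG (@v_adj i (i - 1) _) xz.
- by rewrite eq_sym.
- by rewrite (bc_typ hv).
- by rewrite (bc_typ hv).
rewrite -Ex in xy; have [n] := neighbour xy; rewrite ty => Ey.
have /(chamber_row i)[j Ej] : ch (v i) (act (rot i n) (v (i + 1))) (v (i - 1)).
  by rewrite -(act_chamber hG g) -(actM hG) -Ey Ex Ez.
exists j; rewrite -Ex -Ez -(nb0 g i (i - 1)) Ey; apply: row_label_intro.
by rewrite subr0.
Qed.

(** ** Cycling edge paths *)

(** The function tau gives the types along the path, so that forward-cycling and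
    backward-cycling paths are treated together. *)
Definition cycling_product (tau : nat -> 'Z_3) (c : seq 'Z_(delta q)) (m : nat) : G :=
  (\prod_(k < m) rot (tau k) c`_k)%g.

Lemma cycling_productS tau c m :
  cycling_product tau c m.+1 = (cycling_product tau c m * rot (tau m) c`_m)%g.
Proof. by rewrite /cycling_product big_ord_recr. Qed.

(** The product along the path up to a vertex is a frame at this vertex, and the
    next exponent is the label of the next vertex in it. *)
Lemma edge_path_labels (tau : nat -> 'Z_3) n (p : nat -> V) :
  p 0%N = v (tau 0%N) -> (forall k, (k < n)%N -> adj (p k) (p k.+1)) ->
  (forall k, (k <= n)%N -> typ (p k) = tau k) ->
  exists c : n.-tuple 'Z_(delta q),
    forall k, (k <= n)%N -> p k = act (cycling_product tau c k) (v (tau k)).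
Proof.
move=> p0; elim: n => [|n IH] padj ptyp.
  exists [tuple] => k; rewrite leqn0 => /eqP->.
  by rewrite /cycling_product big_ord0 (act1 hG).
have [k kn|k kn|c pc] := IH.
- by apply: padj; apply: ltnW.
- by apply: ptyp; apply: ltnW.
have /neighbour[r] : adj (act (cycling_product tau c n) (v (tau n))) (p n.+1).
  by rewrite -pc // padj.
rewrite ptyp // => pS; exists [tuple of rcons c r] => k.
have prefix m : (m <= n)%N ->
    cycling_product tau (rcons c r) m = cycling_product tau c m.
  move=> mn; apply: eq_bigr => i _; rewrite nth_rcons size_tuple.
  by rewrite (leq_trans (ltn_ord i) mn).
rewrite leq_eqVlt => /orP[/eqP->|kn]; last by rewrite /= prefix // pc.
by rewrite /= cycling_productS prefix // nth_rcons size_tuple ltnn eqxx.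
Qed.

(** Opposite vertices of a link have different types, so a geodesic never changes
    the direction in which the types cycle. *)
Lemma geodesic_typ (e : 'Z_3) n p : e = 1 \/ e = -1 -> geodesic_path K n p ->
  (0 < n)%N -> typ (p 1%N) = typ (p 0%N) + e ->
  forall k, (k < n)%N -> typ (p k.+1) = typ (p k) + e.
Proof.
move=> he [padj popp] n0 p1; elim=> [//|k IH] kn.
have tk := IH (ltnW kn).
have a1 : adj (p k.+1) (p k) by rewrite adjC; apply/padj/ltnW.
have ne := opposite_typ hX htyp a1 (padj _ kn) (popp k kn).
by case: he tk => -> tk; case: (adj_typ hX htyp (padj _ kn)) => // E1;
  rewrite E1 tk ?addrK ?subrK eqxx in ne.
Qed.

Lemma hjelmslev_elementP (e : 'Z_3) (tau : nat -> 'Z_3) n x :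
  e = 1 \/ e = -1 -> (forall k, tau k = e *+ k) -> (0 < n)%N ->
  hjelmslev_element K typ (v 0) n e x <->
  exists c : n.-tuple 'Z_(delta q),
    let p k := act (cycling_product tau c k) (v (tau k)) in
    geodesic_path K n p /\ x = p n.
Proof.
move=> he Etau n0; split=> [[p [gp p0 pn p1]]|[c [gp ->]]]; last first.
  exists (fun k => act (cycling_product tau c k) (v (tau k))); split=> //.
    by rewrite /cycling_product big_ord0 (act1 hG) Etau mulr0n.
  by rewrite (typ_act hG) (bc_typ hv) Etau mulr1n.
have pS := geodesic_typ he gp n0; rewrite p0 (bc_typ hv) add0r in pS.
have pt k : (k <= n)%N -> typ (p k) = tau k.
  elim: k => [|k IH] kn; first by rewrite p0 (bc_typ hv) Etau mulr0n.
  by rewrite pS // IH ?(ltnW kn) // !Etau mulrSr.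
have [|c pc] := @edge_path_labels tau n p _ (proj1 gp) pt.
  by rewrite p0 Etau mulr0n.
by exists c; split; [apply: geodesic_ext pc gp | rewrite -pn pc].
Qed.

Section Sides.
Variables b a : seq 'Z_(delta q).

Definition forward_frame (m : nat) : G := cycling_product (fun k => k%:R) b m.
Definition backward_frame (n : nat) : G := cycling_product (fun k => - k%:R) a n.

Lemma forward_frame0 : forward_frame 0 = 1%g.
Proof. by rewrite /forward_frame /cycling_product big_ord0. Qed.

Lemma backward_frame0 : backward_frame 0 = 1%g.
Proof. by rewrite /backward_frame /cycling_product big_ord0. Qed.

Local Notation fwd := (forward_path act sigma v b).
Local Notation bwd := (backward_path act sigma v a).

Lemma forwardE m : fwd m = act (forward_frame m) (v (mtyp (m, 0%N))).
Proof. by rewrite /mtyp subr0. Qed.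

Lemma forward_next m :
  fwd m.+1 = nb (forward_frame m) (mtyp (m, 0%N)) (mtyp (m, 0%N) + 1) b`_m.
Proof.
by rewrite -mtypSl forwardE /forward_frame cycling_productS /nb /mtyp /= !subr0.
Qed.

(** The exponent b^m is absorbed by the frame at the next vertex, in which the
    vertex before it therefore has label 0. *)
Lemma forward_prev m :
  fwd m = nb (forward_frame m.+1) (mtyp (m.+1, 0%N)) (mtyp (m.+1, 0%N) - 1) 0.
Proof.
rewrite nb0 mtypSl addrK /forward_frame cycling_productS forwardE.
by rewrite /mtyp /= !subr0 act_rot_v.
Qed.

Lemma backwardE n : bwd n = act (backward_frame n) (v (mtyp (0%N, n))).
Proof. by rewrite /mtyp sub0r. Qed.

Lemma backward_next n :
  bwd n.+1 = nb (backward_frame n) (mtyp (0%N, n)) (mtyp (0%N, n) - 1) a`_n.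
Proof.
by rewrite -mtypSr backwardE /backward_frame cycling_productS /nb /mtyp /= !sub0r.
Qed.

Lemma backward_prev n :
  bwd n = nb (backward_frame n.+1) (mtyp (0%N, n.+1)) (mtyp (0%N, n.+1) + 1) 0.
Proof.
rewrite nb0 mtypSr subrK /backward_frame cycling_productS backwardE.
by rewrite /mtyp /= !sub0r act_rot_v.
Qed.

(** ** Labelled triangles *)

Definition labelled (l : nat) (F : nat -> nat -> V)
    (L : nat -> nat -> bool -> 'I_q.+1) : Prop :=
  (forall m n, (m + n < l)%N ->
     row_label (L m n true) (mtyp (m, n)) (F m n) (F m.+1 n) (F m n.+1)) /\
  (forall m n, (m + n.+1 < l)%N ->
     row_label (L m n false) (mtyp (m, n)) (F m.+1 n.+1) (F m.+1 n) (F m n.+1)).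

Lemma row_label_turnl j m n x y z :
  row_label j (mtyp (m, n)) x y z -> row_label j (mtyp (m.+1, n)) y z x.
Proof. by move/row_label_turn; rewrite -mtypSl. Qed.

Lemma row_label_turnr j m n x y z :
  row_label j (mtyp (m, n)) x y z -> row_label j (mtyp (m, n.+1)) z x y.
Proof. by move/row_label_turn2; rewrite -mtypSr. Qed.

(** Going around a vertex, the entries of the rows of the chambers are the
    successive differences of the labels of its neighbours, with alternating
    signs, so their alternating sum telescopes. *)
Lemma labelled_star l F L : labelled l F L ->
  (forall k, (k <= l)%N -> F k 0%N = fwd k) ->
  (forall k, (k <= l)%N -> F 0%N k = bwd k) ->
  star_condition l E b a L.
Proof.
case=> pos neg bot left m n mnl i.
have [ip im] : i != i + 1 /\ i != i - 1.
  by case: (Z3_neq i) => n1 n2 _; rewrite eq_sym n1 eq_sym n2.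
case: m n mnl @i ip im => [|m] [|n] mnl i ip im.
- have := pos 0%N 0%N mnl.
  rewrite bot // forwardE bot // forward_next => /row_label_neg.
  rewrite left // backward_next forward_frame0 backward_frame0 => /(nb_inj im)->.
  by rewrite -/i; ring.
(* The half-turn from (0,n+2) to (0,n). *)
- set g := backward_frame n.+1.
  have F0 : F 0%N n.+1 = act g (v i) by rewrite left ?backwardE //; lia.
  have F1 : F 0%N n.+2 = nb g i (i - 1) a`_n.+1 by rewrite left ?backward_next.
  have F5 : F 0%N n = nb g i (i + 1) 0 by rewrite left ?backward_prev //; lia.
  have := pos 0%N n.+1 mnl; rewrite F0 F1 -/i => /row_label_pos F2.
  have := row_label_turnr (neg 0%N n mnl); rewrite F0 F2 -/i => /row_label_neg F3.
  have /pos/row_label_turnr : (0 + n < l)%N by lia.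
  rewrite F0 F3 F5 -/i => /row_label_pos/(nb_inj ip).
  by move=> E0; rewrite [X in _ = X - _]E0; ring.
(* The half-turn from (m+2,0) to (m,0). *)
- set g := forward_frame m.+1.
  have F0 : F m.+1 0%N = act g (v i) by rewrite bot ?forwardE //; lia.
  have F1 : F m.+2 0%N = nb g i (i + 1) b`_m.+1.
    by rewrite bot ?forward_next //; lia.
  have F5 : F m 0%N = nb g i (i - 1) 0 by rewrite bot ?forward_prev //; lia.
  have := pos m.+1 0%N mnl; rewrite F0 F1 -/i => /row_label_neg F2.
  have /neg/row_label_turnl : (m + 1 < l)%N by lia.
  rewrite F0 F2 -/i => /row_label_pos F3.
  have /pos/row_label_turnl : (m + 0 < l)%N by lia.
  rewrite F0 F3 F5 -/i => /row_label_neg/(nb_inj im).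
  by move=> E0; rewrite [X in _ = _ - X]E0; ring.
(* The full turn starting and ending at (m+2,n+1), whose label t cancels. *)
- have := pos m.+1 n.+1 mnl; rewrite -/i => c1; have [g [F0 _ _]] := c1.
  move: c1; rewrite F0 => /row_label_frame[t [F1 F2]].
  have /neg/row_label_turnl : (m + n.+2 < l)%N by lia.
  rewrite F0 F2 -/i => /row_label_pos F3.
  have /pos/row_label_turnl : (m + n.+1 < l)%N by lia.
  rewrite F0 F3 -/i => /row_label_neg F4.
  have /neg : (m + n.+1 < l)%N by lia.
  rewrite F0 F4 -mtypSS -/i => /row_label_pos F5.
  have /pos/row_label_turnr : (m.+1 + n < l)%N by lia.
  rewrite F0 F5 -/i => /row_label_neg F6.
  have /neg/row_label_turnr : (m.+1 + n.+1 < l)%N by lia.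
  rewrite F0 F1 F6 -/i => /row_label_pos/(nb_inj ip) E0.
  transitivity (t - t); last by rewrite !subrr.
  by rewrite [X in _ = _ - X]E0; ring.
Qed.

(** ** Developing a labelling *)

Section Developing.
Variables (l : nat) (L : nat -> nat -> bool -> 'I_q.+1).

Let lab m n s (i : 'Z_3) := E (L m n s) i.

(** The label that the vertex (m+1,n) must have in the frame at (m,n) chosen
    below: for positive n, the vertex (m,n-1) has label 0 there, and the two
    chambers between it and (m+1,n) contribute their entries. *)
Definition right_label (m n : nat) : 'Z_(delta q) :=
  if n is n'.+1 then lab m n' false (mtyp (m, n)) - lab m n' true (mtyp (m, n))
  else b`_m.

(** The label that the vertex (m,n+1) must have in the same frame. *)
Definition up_label (m n : nat) : 'Z_(delta q) :=
  right_label m n - lab m n true (mtyp (m, n)).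

(** Along a column the frames are products as on a backward-cycling path, so that
    the vertex below has label 0. *)
Fixpoint frame (m n : nat) : G :=
  if n is n'.+1 then (frame m n' * rot (mtyp (m, n')) (up_label m n'))%g
  else forward_frame m.

Definition developed (m n : nat) : V := act (frame m n) (v (mtyp (m, n))).

Lemma developed_up m n :
  developed m n.+1 = nb (frame m n) (mtyp (m, n)) (mtyp (m, n) - 1) (up_label m n).
Proof. by rewrite -mtypSr. Qed.

Lemma developed_down m n :
  developed m n = nb (frame m n.+1) (mtyp (m, n.+1)) (mtyp (m, n.+1) + 1) 0.
Proof. by rewrite nb0 mtypSr subrK act_rot_v. Qed.

Lemma developed_bottom m : developed m 0 = fwd m.
Proof. by rewrite forwardE. Qed.

Hypothesis star : star_condition l E b a L.

(** The condition at (0,n) says that the label of (0,n+1) is a^n. *)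
Lemma developed_left n : (n <= l)%N -> developed 0 n = bwd n.
Proof.
move=> nl; rewrite backwardE /developed; congr (act _ _).
elim: n nl => [|n IH] nl; first by rewrite /= forward_frame0 backward_frame0.
rewrite /= IH ?(ltnW nl) // /backward_frame cycling_productS.
congr (_ * _)%g; congr (rot _ _); first by rewrite /mtyp sub0r.
have := @star 0%N n nl; rewrite /=.
rewrite /up_label /right_label /lab; case: n {IH nl} => [|n] st.
  apply: oppr_inj; apply: (addrI b`_0); rewrite -{}st; ring.
by apply: oppr_inj; rewrite -[RHS]add0r -{}st; ring.
Qed.

(** Induction on the row. The columns are developed independently of one another;
    the condition at (m+1,n) makes the negative chamber between the columns m and
    m + 1 close up, and this chamber determines the place of (m+1,n+1) relative
    to (m,n+1). *)
Lemma developed_step n m : (m + n < l)%N ->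
  developed m.+1 n = nb (frame m n) (mtyp (m, n)) (mtyp (m, n) + 1) (right_label m n)
  /\ (if n is n'.+1 then row_label (L m n' false) (mtyp (m, n'))
         (developed m.+1 n) (developed m.+1 n') (developed m n) else True).
Proof.
elim: n m => [|n IH] m mnl.
  by rewrite !developed_bottom forward_next.
have mnl' : (m + n < l)%N by lia.
have [right neg] := IH m mnl'.
have pos : row_label (L m n true) (mtyp (m, n))
    (developed m n) (developed m.+1 n) (developed m n.+1).
  by rewrite right developed_up; apply: row_label_intro; rewrite opprB addrC subrK.
set h := frame m.+1 n; set i := mtyp (m.+1, n).
have F0 : developed m.+1 n = act h (v i) by [].
(* The label of (m,n) in the frame at (m+1,n). *)
pose t : 'Z_(delta q) := if n is n'.+1 then - lab m n' false i else 0.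
have F1 : developed m n = nb h i (i - 1) t.
  rewrite /t {t}; case: n @h @i F0 neg {IH mnl mnl' right pos} => [|n] h i F0.
    by move=> _; rewrite developed_bottom forward_prev.
  rewrite -mtypSS -/i F0 developed_down => /row_label_neg.
  by rewrite sub0r.
have := row_label_turnl pos; rewrite F0 F1 -/i => /row_label_pos F2.
have negc : row_label (L m n false) i (developed m.+1 n) (developed m n.+1)
    (developed m.+1 n.+1).
  rewrite F0 F2 developed_up -/i -/h; apply: row_label_intro.
  have := @star m.+1 n; rewrite /= addSnnS => /(_ mnl).
  rewrite /up_label /right_label /t /lab -/i; case: (n) => [|n'] st.
    by rewrite -[b`_m.+1]subr0 -st; ring.
  transitivity (E (L m n'.+1 false) i + (0 - 0)); last by rewrite subr0 addr0.
  by rewrite -st; ring.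
have neg' : row_label (L m n false) (mtyp (m, n)) (developed m.+1 n.+1)
    (developed m.+1 n) (developed m n.+1).
  by have := row_label_turn2 negc; rewrite /i mtypSl addrK.
split=> //.
have := row_label_turnr pos; rewrite (developed_down m n) => /row_label_neg F3.
have := row_label_turnr neg'; rewrite F3 => /row_label_pos ->.
by congr nb; rewrite /right_label /lab sub0r addrC.
Qed.

Lemma developed_labelled : labelled l developed L.
Proof.
split=> m n mnl; last by have [_] := developed_step mnl.
have [right _] := developed_step mnl.
by rewrite right developed_up; apply: row_label_intro; rewrite opprB addrC subrK.
Qed.

End Developing.
End Sides.

(** ** Incidence *)

Lemma extend_labels l (lam : mchamber l -> 'I_q.+1) :
  exists L : nat -> nat -> bool -> 'I_q.+1,
    forall c, lam c = L (code c).1.1 (code c).1.2 (code c).2.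
Proof.
exists (fun m n s =>
  if [pick c | code c == (m, n, s)] is Some c then lam c else ord0).
move=> c; case: pickP => [c' /eqP|/(_ c)]; rewrite -!surjective_pairing ?eqxx //.
by move/code_inj->.
Qed.

(** Two vertices of a chamber determine the type of the third one, so the types on
    the bottom side propagate upwards. *)
Lemma typed_triangle l (b : seq 'Z_(delta q)) F :
  (forall m n, (m + n < l)%N -> ch (F m n) (F m.+1 n) (F m n.+1)) ->
  (forall k, (k <= l)%N -> F k 0%N = forward_path act sigma v b k) ->
  forall m n, (m + n <= l)%N -> typ (F m n) = mtyp (m, n).
Proof.
move=> pos bot m n; elim: n m => [|n IH] m mnl.
  by rewrite bot ?forwardE ?(typ_act hG) ?(bc_typ hv) //; lia.
have c : ch (F m n) (F m.+1 n) (F m n.+1) by apply: pos; lia.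
have t0 : typ (F m n) = mtyp (m, n) by apply: IH; lia.
rewrite mtypSr -t0; apply: (chamber_typ_eq htyp c).
by rewrite t0 -mtypSl; apply: IH; lia.
Qed.

Lemma labels_exist l F :
  (forall m n, (m + n < l)%N -> ch (F m n) (F m.+1 n) (F m n.+1)) ->
  (forall m n, (m + n.+1 < l)%N -> ch (F m.+1 n.+1) (F m.+1 n) (F m n.+1)) ->
  (forall m n, (m + n <= l)%N -> typ (F m n) = mtyp (m, n)) ->
  exists (lam : mchamber l -> 'I_q.+1) L,
    (forall c, lam c = L (code c).1.1 (code c).1.2 (code c).2) /\ labelled l F L.
Proof.
move=> pos neg tF.
pose P (t : nat * nat * bool) j := let: (m, n, s) := t in
  row_label j (mtyp (m, n)) (if s then F m n else F m.+1 n.+1) (F m.+1 n) (F m n.+1).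
have Pex (c : mchamber l) : exists j, P (code c) j.
  case: c => [[[m n] s] /= h]; rewrite /code /=.
  case: s h => h; apply: row_label_exists.
  - by apply: pos; move: h; rewrite /in_model /=; lia.
  - by apply: tF; move: h; rewrite /in_model /=; lia.
  - by rewrite -mtypSl; apply: tF; move: h; rewrite /in_model /=; lia.
  - by apply: neg; move: h; rewrite /in_model /=; lia.
  - by rewrite -mtypSS; apply: tF; move: h; rewrite /in_model /=; lia.
  - by rewrite -mtypSl; apply: tF; move: h; rewrite /in_model /=; lia.
have [lam lamP] := fin_all_exists Pex; have [L EL] := extend_labels lam.
exists lam, L; split=> //; split=> m n mnl.
  have [|c Ec] := @mchamber_code l m n true; first by rewrite /= /in_model /=; lia.
  by have := lamP c; rewrite EL Ec.
have [|c Ec] := @mchamber_code l m n false; first by rewrite /= /in_model /=; lia.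
by have := lamP c; rewrite EL Ec.
Qed.

(** The sides of an embedded triangle are geodesics with the same end points as the
    two given paths, hence equal to them. *)
Lemma incident_labelling l (b a : l.-tuple 'Z_(delta q)) :
  geodesic_path K l (forward_path act sigma v b) ->
  geodesic_path K l (backward_path act sigma v a) ->
  hjelmslev_incident K (v 0) l (forward_path act sigma v b l)
    (backward_path act sigma v a l) <->
  exists lam : mchamber l -> 'I_q.+1, labeling_condition E b a lam.
Proof.
move=> gb ga; split=> [[f [/regular_triangleP[pos neg inj] f0 fb fa]]|[lam hlam]].
  pose F m n := f (m, n).
  have Finj m n m' n' : (m + n <= l)%N -> (m' + n' <= l)%N ->
      F m n = F m' n' -> (m, n) = (m', n') by move=> *; apply: inj.
  have bot : forall k, (k <= l)%N -> F k 0%N = forward_path act sigma v b k.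
    have gF := geodesic_reduced hX htyp (embedded_bottom_geodesic hX htyp pos neg Finj).
    have [|//] := reduced_path_unique hX htyp gF (geodesic_reduced hX htyp gb) _ fb.
    by rewrite forwardE forward_frame0 (act1 hG) f0 /mtyp subrr.
  have left : forall k, (k <= l)%N -> F 0%N k = backward_path act sigma v a k.
    have gF := geodesic_reduced hX htyp (embedded_left_geodesic hX htyp pos neg Finj).
    have [|//] := reduced_path_unique hX htyp gF (geodesic_reduced hX htyp ga) _ fa.
    by rewrite backwardE backward_frame0 (act1 hG) f0 /mtyp subrr.
  have [lam [L [EL hL]]] := labels_exist pos neg (typed_triangle pos bot).
  by exists lam; apply/(labeling_starP _ _ _ EL)/(labelled_star hL).
have [L EL] := extend_labels lam; have /(labeling_starP _ _ _ EL) star := hlam.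
have [pos neg] := developed_labelled star.
have pos' m n h := row_label_chamber (pos m n h).
have neg' m n h := row_label_chamber (neg m n h).
have bot k (_ : (k <= l)%N) := developed_bottom b L k.
have left k (kl : (k <= l)%N) := developed_left star kl.
exists (fun p => developed b L p.1 p.2); split; rewrite /= ?bot ?left //.
  apply/regular_triangleP; split=> // -[m n] [m' n'] mn mn' /= Emn.
  have gbot : geodesic_path K l (fun k => developed b L k 0).
    by apply: geodesic_ext gb => k kl; rewrite bot.
  have gleft : geodesic_path K l (developed b L 0).
    by apply: geodesic_ext ga => k kl; rewrite left.
  suff [-> ->] : m = m' /\ n = n' by [].
  by apply: (immersed_injective hX htyp pos' neg' (typed_triangle pos' bot) gbot gleft).
by rewrite forwardE forward_frame0 (act1 hG) /mtyp subrr.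
Qed.

End Presentation.

Theorem theorem9p6 (q : nat) (V : choiceType) (K : {pred {fset V}})
    (typ : V -> 'Z_3) (G : groupType) (act : G -> V -> V)
    (sigma : 'Z_3 -> G) (E : 'M['Z_(delta q)]_(q.+1, 3)) (v : 'Z_3 -> V)
    (l : nat)
    (hq : prime_power q)
    (hG : singer_cyclic_lattice q K typ act)
    (hE : presenting_triple sigma E)
    (hv : base_chamber K typ act sigma v)
    (hl : (1 <= l)%N) :
  [/\ (forall x : V, hjelmslev_point K typ (v 0) l x <->
         exists b : l.-tuple 'Z_(delta q),
           geodesic_path K l (forward_path act sigma v b) /\
           x = forward_path act sigma v b l),
      (forall y : V, hjelmslev_line K typ (v 0) l y <->
         exists a : l.-tuple 'Z_(delta q),
           geodesic_path K l (backward_path act sigma v a) /\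
           y = backward_path act sigma v a l)
    & (forall b a : l.-tuple 'Z_(delta q),
         geodesic_path K l (forward_path act sigma v b) ->
         geodesic_path K l (backward_path act sigma v a) ->
         (hjelmslev_incident K (v 0) l (forward_path act sigma v b l)
                                       (backward_path act sigma v a l) <->
          exists lam : mchamber l -> 'I_q.+1, labeling_condition E b a lam))].
Proof.
have q0 : (0 < q)%N.
  by have [p [k [p_pr _ ->]]] := hq; rewrite expn_gt0 prime_gt0.
split.
- move=> x; apply: (hjelmslev_elementP q0 hG hE hv (e := 1) x) => //.
    by left.
- move=> y; have -> : hjelmslev_line K typ (v 0) l y =
      hjelmslev_element K typ (v 0) l (-1) y.
    by rewrite /hjelmslev_line; congr (hjelmslev_element _ _ _ _ _ _); apply/eqP.
  apply: (hjelmslev_elementP q0 hG hE hv (e := -1) y) => //; first by right.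
  by move=> k; rewrite mulNrn.
- by move=> b a gb ga; apply: (incident_labelling q0 hG hE hv gb ga).
Qed.
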